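(* Let $d\ge2$, $1<\alpha\le d+1$, and $1\le p,q\le\infty$. Suppose that there is a constant $C$ such that $$\|\mathcal A f\|_{L^q(\mathbb B^d(0,1)\times I;\,d\nu)}\le C\langle\nu\rangle_\alpha^{1/q}\|f\|_{L^p(\mathbb R^d)}$$ holds for all $f\in L^p(\mathbb R^d)$ and all $\nu\in\mathfrak C^{d+1}(\alpha)$. Then: (i) $p^{-1}\le\alpha q^{-1}$; (ii) $(d+1)p^{-1}\le d-1+(\alpha-1)q^{-1}$ if $1<\alpha\le d$, and $(d+1)p^{-1}\le d-1+(2\alpha-d-1)q^{-1}$ if $d<\alpha\le d+1$; (iii) $dp^{-1}\le d-1$ if $1<\alpha\le d$, and $dp^{-1}\le d-1+(\alpha-d)q^{-1}$ if $d<\alpha\le d+1$. Furthermore, if $d\ge3$ and $k<\alpha\le k+1$ for an integer $k\in[1,d-1]$, then: (iv) $(d+k)p^{-1}\le d+k-2+(\alpha-k)q^{-1}$ and $p^{-1}\le\frac{d+k-1}{d+k+1}$; (v) $(k+1)p^{-1}\le k+(\alpha-k)q^{-1}$ and $p^{-1}\le\frac{k+1}{k+2}$. Finally, if $d=2$ and $1<\alpha\le3$, then: (vi) $p\ge4-\alpha$.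
   Context: $I=(1,2)$. The spherical average is $\mathcal A f(x,t)=\int_{\mathbb S^{d-1}}f(x-ty)\,d\sigma(y)$, $x\in\mathbb R^d$, where $d\sigma$ is the normalized surface measure on the unit sphere $\mathbb S^{d-1}$. $\mathbb B^n(z,\rho)$ is the open ball of radius $\rho$ centered at $z$ in $\mathbb R^n$. $\mathfrak C^{d+1}(\alpha)$ is the class of non-negative Borel measures $\nu$ on $\mathbb R^{d+1}$ for which there is a constant $C_\nu$ with $\nu(\mathbb B^{d+1}(z,\rho))\le C_\nu\rho^\alpha$ for all $z\in\mathbb R^{d+1}$, $\rho>0$; and $\langle\nu\rangle_\alpha:=\sup_{z\in\mathbb R^{d+1},\rho>0}\rho^{-\alpha}\nu(\mathbb B^{d+1}(z,\rho))$. *)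

(* Defs.v *)
From HB Require Import structures.
From mathcomp Require Import all_boot all_order all_algebra.
From mathcomp Require Import all_classical all_reals all_analysis.
From mathcomp Require Import measurable_realfun.
Set Implicit Arguments.
Unset Strict Implicit.
Unset Printing Implicit Defensive.
Import Order.TTheory GRing.Theory Num.Theory.
Import numFieldNormedType.Exports.
Local Open Scope classical_set_scope.
Local Open Scope ring_scope.

(* The Borel sigma-algebra of R^n, generated by the coordinates exactly as the
   library does for n.-tuple T. *)
Section measurable_rV.
Context {R : realType} {n : nat}.

Let coords (i : 'I_n) (x : 'rV[R]_n) : R := x ord0 i.

Let rV_measurable0 : g_sigma_preimage coords set0.
Proof. exact: sigma_algebra0. Qed.

Let rV_measurableC A : g_sigma_preimage coords A -> g_sigma_preimage coords (~` A).
Proof. exact: sigma_algebraC. Qed.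

Let rV_measurable_bigcup (F : (set 'rV[R]_n)^nat) :
  (forall i, g_sigma_preimage coords (F i)) ->
  g_sigma_preimage coords (\bigcup_i F i).
Proof. exact: sigma_algebra_bigcup. Qed.

HB.instance Definition _ := @isMeasurable.Build default_measure_display
  'rV[R]_n (g_sigma_preimage coords)
  rV_measurable0 rV_measurableC rV_measurable_bigcup.

Lemma measurable_coord (i : 'I_n) :
  measurable_fun [set: 'rV[R]_n] (fun x : 'rV[R]_n => x ord0 i).
Proof.
move=> _ Y mY; rewrite setTI; apply: sub_sigma_algebra.
rewrite -bigcup_seq/=; exists i => /=; first by rewrite mem_index_enum.
by exists Y => //; rewrite setTI.
Qed.

Lemma measurable_fun_rV d (T : measurableType d) (f : T -> 'rV[R]_n) :
  (forall i, measurable_fun [set: T] (fun t => f t ord0 i)) ->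
  measurable_fun [set: T] f.
Proof.
move=> mf _ Y mY; rewrite setTI.
pose F := image_set_system [set: T] f measurable.
suff: F Y by rewrite /F /image_set_system /= setTI.
move: Y mY; apply: smallest_sub.
  exact: (sigma_algebra_image _ (@sigma_algebra_measurable _ T)).
rewrite -bigcup_seq => A [i _ [B mB <-]].
rewrite /F /image_set_system /= !setTI -comp_preimage -[X in measurable X]setTI.
exact: mf.
Qed.

End measurable_rV.

Section euclidean.
Context {R : realType} {n : nat}.
Implicit Types x : 'rV[R]_n.

(* The norm `|x| of the library on 'rV[R]_n is the sup norm. *)
Definition enorm x : R := Num.sqrt (\sum_i x ord0 i ^+ 2).

Definition eball x (r : R) : set 'rV[R]_n := [set y | enorm (y - x) < r].

(* R^(n+1), seen as R^n * R. *)
Definition enorm1 (z : 'rV[R]_n * R) : R := Num.sqrt (enorm z.1 ^+ 2 + z.2 ^+ 2).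

Definition eball1 (z : 'rV[R]_n * R) (r : R) : set ('rV[R]_n * R) :=
  [set w | enorm1 (w - z) < r].

Definition direction x : 'rV[R]_n := (enorm x)^-1 *: x.

Lemma measurable_enorm : measurable_fun [set: 'rV[R]_n] enorm.
Proof.
apply: (@measurableT_comp _ _ _ _ _ _ (@Num.sqrt R)).
  exact: continuous_measurable_fun (@sqrt_continuous R).
by apply: measurable_sum => i; exact: measurable_funX (measurable_coord i).
Qed.

Lemma measurable_direction : measurable_fun [set: 'rV[R]_n] direction.
Proof.
apply: measurable_fun_rV => i.
rewrite (_ : (fun _ => _) = (fun x => enorm x `^ (-1) * x ord0 i)); last first.
  by apply/funext => x; rewrite powR_inv1 ?sqrtr_ge0// /direction mxE.
apply: measurable_funM; last exact: measurable_coord.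
exact: (measurableT_comp (measurable_powR (-1)) measurable_enorm).
Qed.

End euclidean.

Section lebesgue_rV.
Context {R : realType}.

Definition rV_cons n (p : 'rV[R]_n * R) : 'rV[R]_n.+1 :=
  row_mx (p.2%:M : 'rV[R]_1) p.1.

Lemma measurable_rV_cons n : measurable_fun setT (@rV_cons n).
Proof.
apply: measurable_fun_rV => i; rewrite /rV_cons.
case: (@split_ordP 1 n i) => j ->.
  under eq_fun do rewrite (@row_mxEl _ 1 1 n) (ord1 j) mxE.
  exact: measurable_snd.
under eq_fun do rewrite (@row_mxEr _ 1 1 n).
exact: measurableT_comp (measurable_coord j) measurable_fst.
Qed.

(* Lebesgue measure on R^n, as the n-fold product of the measure on R. *)
Fixpoint lebesgue_rV n : set 'rV[R]_n -> \bar R :=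
  match n with
  | 0 => \d_(0%R : 'rV[R]_0)
  | m.+1 => pushforward (@lebesgue_rV m \x lebesgue_measure)%E (@rV_cons m)
  end.

Arguments lebesgue_rV : clear implicits.

Let lebesgue_rV_measure n :
  exists m : {measure set 'rV[R]_n -> \bar R}, lebesgue_rV n = m.
Proof.
elim: n => [|n [m mE]]; first by exists \d_(0 : 'rV[R]_0).
unshelve eexists (pushforward (m \x lebesgue_measure)%E (@rV_cons n)).
  exact: measurable_rV_cons.
by rewrite /= mE.
Qed.

Let lebesgue_rV0 n : lebesgue_rV n set0 = 0%E.
Proof. by have [m ->] := lebesgue_rV_measure n; exact: measure0. Qed.

Let lebesgue_rV_ge0 n A : (0 <= lebesgue_rV n A)%E.
Proof. by have [m ->] := lebesgue_rV_measure n; exact: measure_ge0. Qed.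

Let lebesgue_rV_sigma_additive n : semi_sigma_additive (lebesgue_rV n).
Proof.
by have [m ->] := lebesgue_rV_measure n; exact: measure_semi_sigma_additive.
Qed.

HB.instance Definition _ n := isMeasure.Build _ _ _ (lebesgue_rV n)
  (lebesgue_rV0 n) (@lebesgue_rV_ge0 n) (@lebesgue_rV_sigma_additive n).

End lebesgue_rV.
Arguments lebesgue_rV {R} n _.

Section sphere.
Context {R : realType} {d : nat}.
Local Open Scope ereal_scope.

Definition cone (E : set 'rV[R]_d) : set 'rV[R]_d :=
  direction @^-1` E `&` [set x | (0 < enorm x < 1)%R].

(* Surface measure of the unit sphere by polar coordinates: d times the volume
   of the cone over E.  It is a measure on R^d carried by the sphere, which
   avoids a separate type for the sphere. *)
Definition sphere_surface (E : set 'rV[R]_d) : \bar R :=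
  d%:R%:E * lebesgue_rV d (cone E).

Let mshell : measurable [set x : 'rV[R]_d | (0 < enorm x < 1)%R].
Proof.
rewrite (_ : mkset _ = enorm @^-1` `]0%R, 1%R[); last first.
  by apply/seteqP; split => x; rewrite /= in_itv.
by rewrite -[X in measurable X]setTI; exact: measurable_enorm.
Qed.

Let sphere_surface_measure :
  exists m : {measure set 'rV[R]_d -> \bar R}, sphere_surface = m.
Proof.
unshelve eexists (pushforward (mscale (NngNum (ler0n R d))
  (mrestr (lebesgue_rV d) mshell)) direction).
  exact: measurable_direction.
by [].
Qed.

Let sphere_surface0 : sphere_surface set0 = 0.
Proof. by have [m ->] := sphere_surface_measure; exact: measure0. Qed.

Let sphere_surface_ge0 A : 0 <= sphere_surface A.
Proof. by have [m ->] := sphere_surface_measure; exact: measure_ge0. Qed.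

Let sphere_surface_sigma_additive : semi_sigma_additive sphere_surface.
Proof.
by have [m ->] := sphere_surface_measure; exact: measure_semi_sigma_additive.
Qed.

HB.instance Definition _ := isMeasure.Build _ _ _ sphere_surface
  sphere_surface0 sphere_surface_ge0 sphere_surface_sigma_additive.

(* The second argument of mnormalize is a default for measures of total mass 0
   or +oo; it plays no role when d > 0. *)
Definition sphere_measure : set 'rV[R]_d -> \bar R :=
  mnormalize sphere_surface \d_(0%R : 'rV[R]_d).

HB.instance Definition _ := Measure.on sphere_measure.
HB.instance Definition _ := Probability.on sphere_measure.

Definition spherical_average (f : 'rV[R]_d -> R) (z : 'rV[R]_d * R) : \bar R :=
  \int[sphere_measure]_y (f (z.1 - z.2 *: y)%R)%:E.

End sphere.

Section frostman.
Context {R : realType} {d : nat}.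
Local Open Scope ereal_scope.
Implicit Types nu : {measure set ('rV[R]_d * R) -> \bar R}.

Definition frostman_class (a : R) nu : Prop :=
  exists C : R, forall z (r : R), (0 < r)%R ->
    nu (eball1 z r) <= (C * r `^ a)%:E.

Definition frostman_const (a : R) nu : \bar R :=
  ereal_sup [set s | exists z, exists2 r : R, (0 < r)%R &
    s = (r `^ (- a))%:E * nu (eball1 z r)].

End frostman.

(* Main.v *)
(* The inequality is tested on f = 1_E and on normalized Lebesgue measures nu of
   sets F of centres and radii such that the spheres they define meet E in a set
   of average >= a: it yields a * nu(F)^(1/q) <~ |E|^(1/p), and comparing powers
   of a small scale gives each condition.

   Fix an index j. The spheres with centre X in R^j and radius
   sqrt (9/4 + |X|^2) all contain the same (d - j - 1)-sphere of radius 3/2. E is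
   the delta-neighbourhood of a cap of width eta of that sphere, F a neighbourhood
   of these pairs (X, sqrt (9/4 + |X|^2)), and the centre may moreover move by
   delta / eta^2 in the direction of the cap and by delta / eta along the cap.
   The choice eta = 1 gives (i) and (v), eta ~ sqrt delta gives (ii), (iii) and
   (iv). For (vi), E is a union of translates of such a set along an arithmetic
   progression, dense enough for F to have dimension alpha. *)
Require Import Defs.
From mathcomp Require Import all_boot all_order all_algebra.
From mathcomp Require Import all_classical all_reals all_analysis.
From mathcomp Require Import measurable_realfun ess_sup_inf.
From mathcomp Require Import ring lra zify.
Set Implicit Arguments.
Unset Strict Implicit.
Unset Printing Implicit Defensive.
Import Order.TTheory GRing.Theory Num.Theory.
Import numFieldNormedType.Exports.
Local Open Scope classical_set_scope.
Local Open Scope ring_scope.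

(** * Lebesgue measure of triangular sets *)

(** The measures have to be Frostman at every scale, not only at the smallest one. Share [alpha]
    among the coordinates of a box as exponents [theta_i] in [0, 1]: after division by
    [h_i^(1 - theta_i)], a side of half-length [h_i] contributes at most a multiple of [r^theta_i]
    to a ball of radius [r], and the box keeps a mass comparable to the product of the
    [h_i^theta_i]. Sides of length about 1 absorb exponent at no cost, so a condition comes from one
    choice of [j], [eta] and the exponents.

    The obstacle is that neither F nor the cone over the cap is a box. Both are described by
    conditions on one coordinate that involve only those of larger index; Fubini then measures the
    sections, and no Jacobian is computed.

    Condition (vi) is free of [q], so the mass of [nu] must not shrink. A progression lets a short
    side carry a fractional exponent at bounded mass, paid for by the number of plates in E. *)

Section lebesgue_triangular.
Context {R : realType}.

Lemma rV_cons0 n (x : 'rV[R]_n) s : rV_cons (x, s) ord0 ord0 = s.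
Proof.
rewrite /rV_cons mxE; case: splitP => j //= _.
by rewrite (ord1 j) mxE eqxx mulr1n.
Qed.

Lemma rV_consS n (x : 'rV[R]_n) s i :
  rV_cons (x, s) ord0 (lift ord0 i) = x ord0 i.
Proof.
rewrite /rV_cons mxE; case: splitP => j /=; first by rewrite (ord1 j).
by rewrite /bump/= !add1n => -[ij]; congr (x _ _); apply/val_inj.
Qed.

Lemma measurable_forall d (T : measurableType d) (I : finType)
    (D : I -> set T) : (forall i, measurable (D i)) ->
  measurable [set z | forall i, D i z].
Proof.
move=> mD; rewrite (_ : mkset _ = \bigcap_(i in [set: I]) D i).
  exact: fin_bigcap_measurable.
by apply/seteqP; split => [z Dz i _|z Dz i]; exact: Dz.
Qed.

(** No section depends on coordinate 0, the smallest index, so a dummy [0] can stand there. What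
    remains is a triangular condition in dimension [n] and one section over it: the inductive step
    of both Fubini bounds. *)
Lemma rV_cons_triangular n (S : 'I_n.+1 -> 'rV[R]_n.+1 -> set R)
    (x : 'rV[R]_n) s :
  (forall (i : 'I_n.+1) (z z' : 'rV[R]_n.+1) r,
    (forall k : 'I_n.+1, (i < k)%N -> z ord0 k = z' ord0 k) ->
    S i z r -> S i z' r) ->
  (forall i, S i (rV_cons (x, s)) (rV_cons (x, s) ord0 i)) <->
  (forall i, S (lift ord0 i) (rV_cons (x, 0)) (x ord0 i)) /\
    S ord0 (rV_cons (x, 0)) s.
Proof.
move=> depS.
have E r r' i : S i (rV_cons (x, r)) `<=` S i (rV_cons (x, r')).
  move=> u; apply: depS => k; have [j ->|->//] := unliftP ord0 k.
  by rewrite !rV_consS.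
split=> [H|[H H0] i].
  split; last by have := H ord0; rewrite rV_cons0; exact: E.
  by move=> i; have := H (lift ord0 i); rewrite rV_consS; exact: E.
have [j ->|->] := unliftP ord0 i; last by rewrite rV_cons0; exact: E H0.
by rewrite rV_consS; exact: E (H j).
Qed.

Lemma measurable_cons_slice n (S : 'I_n.+1 -> 'rV[R]_n.+1 -> set R) i :
  measurable [set z : 'rV[R]_n.+1 | S (lift ord0 i) z (z ord0 (lift ord0 i))] ->
  measurable [set x | S (lift ord0 i) (rV_cons (x, 0)) (x ord0 i)].
Proof.
move=> mS.
have mc : measurable_fun [set: 'rV[R]_n] (fun x : 'rV[R]_n => rV_cons (x, 0 : R)).
  apply: (measurableT_comp (@measurable_rV_cons R n)).
  exact: measurable_fun_pair.
have := mc measurableT _ mS; rewrite setTI.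
congr (measurable _); apply/seteqP; split=> x /=; by rewrite rV_consS.
Qed.

(* [S i z] restricts the coordinate [i] and may only depend on the coordinates
   of larger index, so that Fubini integrates out the coordinates in order. *)
Lemma lebesgue_rV_triangular_le n (S : 'I_n -> 'rV[R]_n -> set R)
    (h : 'I_n -> R) :
  (forall i, measurable [set z : 'rV[R]_n | S i z (z ord0 i)]) ->
  (forall (i : 'I_n) (z z' : 'rV[R]_n) r,
    (forall k : 'I_n, (i < k)%N -> z ord0 k = z' ord0 k) ->
    S i z r -> S i z' r) ->
  (forall i, 0 <= h i) ->
  (forall i z, (lebesgue_measure (S i z) <= (h i)%:E)%E) ->
  (lebesgue_rV n [set z | forall i, S i z (z ord0 i)] <= (\prod_i h i)%:E)%E.
Proof.
elim: n S h => [|n IH] S h mS depS h0 hS.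
  by rewrite big_ord0 /= /dirac indicE; case: (_ \in _); rewrite lee_fin ?ler01.
rewrite big_ord_recl.
pose S' i (x : 'rV[R]_n) := S (lift ord0 i) (rV_cons (x, 0)).
pose A' := [set x : 'rV[R]_n | forall i, S' i x (x ord0 i)].
have mA' : measurable A'.
  by apply: measurable_forall => i; exact: (measurable_cons_slice (mS (lift ord0 i))).
have IHA : (lebesgue_rV n A' <= (\prod_(i < n) h (lift ord0 i))%:E)%E.
  apply: IH => //.
  - by move=> i; exact: (measurable_cons_slice (mS (lift ord0 i))).
  - move=> i z z' r H; apply: depS => k; have [j ->|->//] := unliftP ord0 k.
    by rewrite !rV_consS /= /bump /= => ij; apply: H.
  - by move=> i z; exact: hS.
set A := [set _ | _].
have mA : measurable A by exact: measurable_forall.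
have mPA : measurable ((@rV_cons R n) @^-1` A).
  by rewrite -[X in measurable X]setTI; exact: measurable_rV_cons.
rewrite /= /pushforward /product_measure1.
apply: (@le_trans _ _ (\int[lebesgue_rV n]_x ((h ord0)%:E * (\1_A' x)%:E))%E).
  apply: ge0_le_integral => //.
  - exact: measurable_fun_xsection.
  - by apply: measurable_funeM; apply/measurable_EFinP; exact: measurable_indic.
  - move=> x _ /=; rewrite indicE; case: (pselect (A' x)) => Ax.
      rewrite mem_set// mule1; apply: le_trans (hS ord0 (rV_cons (x, 0))).
      apply: le_outer_measure => s; rewrite /xsection /= inE /= /A /=.
      by move/(rV_cons_triangular x s depS) => [].
    rewrite memNset// mule0 le_eqVlt; apply/orP; left; apply/eqP.
    rewrite (_ : xsection _ _ = set0) ?measure0//.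
    apply/seteqP; split=> // s; rewrite /xsection /= inE /= /A /=.
    by move/(rV_cons_triangular x s depS) => [].
rewrite ge0_integralZl_EFin//; last first.
    by apply/measurable_EFinP; exact: measurable_indic.
rewrite integral_indic// setIT EFinM; apply: lee_pmul => //.
by rewrite lee_fin.
Qed.

Lemma lebesgue_rV_triangular_ge n (S : 'I_n -> 'rV[R]_n -> set R)
    (h : 'I_n -> R) :
  (forall i, measurable [set z : 'rV[R]_n | S i z (z ord0 i)]) ->
  (forall (i : 'I_n) (z z' : 'rV[R]_n) r,
    (forall k : 'I_n, (i < k)%N -> z ord0 k = z' ord0 k) ->
    S i z r -> S i z' r) ->
  (forall i, 0 <= h i) ->
  (forall i z, ((h i)%:E <= lebesgue_measure (S i z))%E) ->
  ((\prod_i h i)%:E <= lebesgue_rV n [set z | forall i, S i z (z ord0 i)])%E.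
Proof.
elim: n S h => [|n IH] S h mS depS h0 hS.
  by rewrite big_ord0 /= /dirac indicE mem_set// => -[].
rewrite big_ord_recl.
pose S' i (x : 'rV[R]_n) := S (lift ord0 i) (rV_cons (x, 0)).
pose A' := [set x : 'rV[R]_n | forall i, S' i x (x ord0 i)].
have mA' : measurable A'.
  by apply: measurable_forall => i; exact: (measurable_cons_slice (mS (lift ord0 i))).
have IHA : ((\prod_(i < n) h (lift ord0 i))%:E <= lebesgue_rV n A')%E.
  apply: IH => //.
  - by move=> i; exact: (measurable_cons_slice (mS (lift ord0 i))).
  - move=> i z z' r H; apply: depS => k; have [j ->|->//] := unliftP ord0 k.
    by rewrite !rV_consS /= /bump /= => ij; apply: H.
  - by move=> i z; exact: hS.
set A := [set _ | _].
have mA : measurable A by exact: measurable_forall.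
have mPA : measurable ((@rV_cons R n) @^-1` A).
  by rewrite -[X in measurable X]setTI; exact: measurable_rV_cons.
rewrite /= /pushforward /product_measure1.
apply: (@le_trans _ _ (\int[lebesgue_rV n]_x ((h ord0)%:E * (\1_A' x)%:E))%E).
  rewrite ge0_integralZl_EFin//; last first.
    by apply/measurable_EFinP; exact: measurable_indic.
  rewrite integral_indic// setIT EFinM; apply: lee_pmul => //.
  - by rewrite lee_fin.
  - by rewrite lee_fin prodr_ge0.
apply: ge0_le_integral => //.
- by move=> x _; rewrite -EFinM lee_fin mulr_ge0// indicE.
- by apply: measurable_funeM; apply/measurable_EFinP; exact: measurable_indic.
- exact: measurable_fun_xsection.
- move=> x _ /=; rewrite indicE; case: (pselect (A' x)) => Ax; last first.
    by rewrite memNset// mule0.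
  rewrite mem_set// mule1; apply: (le_trans (hS ord0 (rV_cons (x, 0)))).
  apply: le_outer_measure => s Ss; rewrite /xsection /= inE /= /A /=.
  by apply/(rV_cons_triangular x s depS).
Qed.

End lebesgue_triangular.

(** * Testing on indicator functions *)

Section Lnorm_bounds.
Context d {T : measurableType d} {R : realType}.
Variable mu : {measure set T -> \bar R}.
Local Open Scope ereal_scope.

Lemma Lnorm_indic_le (p : \bar R) (E : set T) (V : R) :
  1 <= p -> measurable E -> (0 <= V)%R -> mu E <= V%:E ->
  'N[mu]_p[EFin \o \1_E] <= (V `^ fine p^-1)%:E.
Proof.
move=> p1 mE V0 EV; rewrite unlock.
case: p p1 => [r| |//]; rewrite ?lee_fin => r1.
  have r0 : (0 < r)%R by rewrite (lt_le_trans _ r1).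
  rewrite fine_invr; under eq_integral => x _.
    rewrite (_ : `|_| `^ r = (\1_E x)%:E); last first.
      rewrite /= indicE; case: (_ \in _); rewrite /= ?normr1 ?powR1//.
      by rewrite normr0 powR0// gt_eqF.
    over.
  rewrite integral_indic// setIT -poweR_EFin.
  apply: gt0_ler_poweR; rewrite ?invr_ge0 ?(ltW r0)// in_itv/= ?leey ?andbT//.
(* For [p = +oo] the exponent is 0 and the bound is [V ^ 0 = 1], also when [V = 0]. *)
rewrite invey /= powRr0; case: ifPn => // _.
apply/ess_supP; apply: nearW => x /=.
by rewrite lee_fin indicE; case: (_ \in _); rewrite ?normr1 ?normr0.
Qed.

Lemma Lnorm_ge (q : \bar R) (g : T -> \bar R) (F : set T) (a m : R) :
  1 <= q -> measurable F -> measurable_fun setT g -> (0 <= a)%R -> (0 < m)%R ->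
  (forall x, F x -> a%:E <= g x) -> m%:E <= mu F ->
  (a * m `^ fine q^-1)%:E <= 'N[mu]_q[g].
Proof.
move=> q1 mF mg a0 m0 ag mF0; rewrite unlock.
have ag' x : F x -> a%:E <= `|g x|.
  by move=> /ag /le_trans; apply; exact: lee_abs.
case: q q1 => [r| |//]; rewrite ?lee_fin => r1.
  have r0 : (0 < r)%R by rewrite (lt_le_trans _ r1).
  rewrite fine_invr (_ : (a * _)%:E = ((a `^ r * m)%:E) `^ r^-1); last first.
    rewrite poweR_EFin powRM ?powR_ge0 ?(ltW m0)// -powRrM mulfV ?gt_eqF//.
    by rewrite powRr1.
  apply: gt0_ler_poweR; rewrite ?invr_ge0 ?(ltW r0)// ?in_itv/= ?leey ?andbT//.
  - by rewrite lee_fin mulr_ge0 ?powR_ge0// ltW.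
  - by apply: integral_ge0 => x _; exact: poweR_ge0.
  have mgr : measurable_fun setT (fun x => `|g x| `^ r).
    apply: (measurableT_comp (measurable_poweR r)).
    exact: measurableT_comp.
  apply: (@le_trans _ _ (\int[mu]_(x in F) `|g x| `^ r)); last first.
    apply: ge0_subset_integral => //.
    by move=> x _; exact: poweR_ge0.
  rewrite EFinM; apply: (@le_trans _ _ ((a `^ r)%:E * mu F)).
    by rewrite lee_pmul ?lee_fin ?powR_ge0 ?(ltW m0).
  rewrite -integral_cst//; apply: ge0_le_integral => //.
  - by move=> x _; rewrite lee_fin powR_ge0.
  - by apply: measurable_funTS.
  - move=> x Fx /=; rewrite -poweR_EFin.
    apply: gt0_ler_poweR; rewrite ?(ltW r0)// ?in_itv/= ?leey ?andbT//.
    exact: ag'.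
rewrite invey /= powRr0 mulr1 ifT; last first.
  apply: (@lt_le_trans _ _ (mu F)); first exact: lt_le_trans mF0.
  by apply: le_measure => //; rewrite inE.
(* If the essential supremum were below [a], then [F] would lie in a null set, against
   [mu F >= m > 0]. *)
rewrite leNgt; apply/negP => lta.
have [N [mN N0 sN]] := ess_sup_ge mu (abse \o g).
suff : mu F <= 0 by rewrite leNgt (lt_le_trans _ mF0)// lte_fin.
rewrite -N0; apply: le_measure; rewrite ?inE//.
move=> x Fx; apply: sN => /= H.
by have := le_lt_trans (le_trans (ag' x Fx) H) lta; rewrite ltxx.
Qed.

End Lnorm_bounds.

Section spherical_test.
Context {R : realType} {d : nat}.
Local Open Scope ereal_scope.

Definition spherical_estimate (alpha : R) (p q : \bar R) (C : R) : Prop :=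
  forall (f : 'rV[R]_d -> R) (nu : {measure set ('rV[R]_d * R) -> \bar R}),
  f \in Lfun (lebesgue_rV d) p -> frostman_class alpha nu ->
  'N[nu]_q[spherical_average f \_ (eball 0%R 1%R `*` `]1%R, 2%R[)]
     <= C%:E * frostman_const alpha nu `^ fine q^-1
        * 'N[lebesgue_rV d]_p[EFin \o f].

Definition domain : set ('rV[R]_d * R) := eball 0%R 1%R `*` `]1%R, 2%R[.

Lemma measurable_domain : measurable domain.
Proof.
apply: measurableX; last exact: measurable_itv.
rewrite (_ : eball _ _ = enorm @^-1` `]-oo, 1%R[); last first.
  by apply/seteqP; split => x; rewrite /eball /= subr0 in_itv.
by rewrite -[X in measurable X]setTI; exact: measurable_enorm.
Qed.

Lemma measurable_sphere_point : measurable_fun [set: ('rV[R]_d * R) * 'rV[R]_d]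
  (fun u => u.1.1 - u.1.2 *: u.2)%R.
Proof.
apply: measurable_fun_rV => i.
under eq_fun do rewrite !mxE.
apply: measurable_funB.
  by apply: (measurableT_comp (measurable_coord i)); apply: (measurableT_comp measurable_fst measurable_fst).
apply: measurable_funM.
  by apply: (measurableT_comp measurable_snd measurable_fst).
exact: (measurableT_comp (measurable_coord i) measurable_snd).
Qed.

Lemma spherical_average_indic (E : set 'rV[R]_d) z : measurable E ->
  spherical_average \1_E z =
  sphere_measure [set y | E (z.1 - z.2 *: y)%R].
Proof.
move=> mE; rewrite /spherical_average.
have mE' : measurable [set y | E (z.1 - z.2 *: y)%R].
  have m1 : measurable_fun setT (fun y : 'rV[R]_d => (z.1 - z.2 *: y)%R).
    exact: (measurableT_comp measurable_sphere_point (pair1_measurable z)).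
  by rewrite -[X in measurable X]setTI; exact: m1.
by set A := [set y | _] in mE' *; rewrite -[A in RHS]setIT -integral_indic//.
Qed.

Lemma measurable_spherical_average (E : set 'rV[R]_d) : measurable E ->
  measurable_fun [set: 'rV[R]_d * R] (spherical_average \1_E).
Proof.
move=> mE.
rewrite (_ : spherical_average _ = fun z =>
    sphere_measure [set y | E (z.1 - z.2 *: y)%R]); last first.
  by apply/funext => z; exact: spherical_average_indic.
pose A := [set u : ('rV[R]_d * R) * 'rV[R]_d | E (u.1.1 - u.1.2 *: u.2)%R].
have mA : measurable A.
  by rewrite -[X in measurable X]setTI; exact: measurable_sphere_point.
have := @measurable_fun_xsection _ _ _ _ _ (@sphere_measure R d) A mA.
congr measurable_fun; apply/funext => z /=; congr (sphere_measure _).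
by apply/seteqP; split=> y; rewrite /xsection /= inE.
Qed.

(** The normalisation of [nu] makes its Frostman constant at most 1, so that factor drops out. [C]
    becomes [|C|] because its sign is unknown. The set of good pairs is measurable, being a
    superlevel set of the average of an indicator. *)
Lemma spherical_estimate_test (alpha : R) (p q : \bar R) (C : R)
    (E : set 'rV[R]_d) (nu : {measure set ('rV[R]_d * R) -> \bar R})
    (a m V : R) :
  1 <= p -> 1 <= q -> spherical_estimate alpha p q C ->
  measurable E -> (0 <= V)%R -> lebesgue_rV d E <= V%:E ->
  (forall z (r : R), (0 < r)%R -> nu (eball1 z r) <= (r `^ alpha)%:E) ->
  (0 <= a)%R -> (0 < m)%R ->
  m%:E <= nu (domain `&`
    [set z | a%:E <= sphere_measure [set y | E (z.1 - z.2 *: y)%R]]) ->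
  (a * m `^ fine q^-1 <= `|C| * V `^ fine p^-1)%R.
Proof.
move=> p1 q1 HC mE V0 EV nu1 a0 m0.
set F := _ `&` _ => mF0.
have mA := measurable_spherical_average mE.
have FE : F = domain `&` [set z | a%:E <= spherical_average \1_E z].
  by congr setI; apply/seteqP; split => z /=; rewrite spherical_average_indic.
have mF : measurable F.
  rewrite FE; apply: emeasurable_fun_c_infty.
    exact: measurable_domain.
  exact: measurable_funTS.
have ELp : \1_E \in Lfun (lebesgue_rV d) p.
  apply/andP; split; rewrite inE/=; first exact: measurable_indic.
  by apply: le_lt_trans (Lnorm_indic_le p1 mE V0 EV) _; rewrite ltry.
have Fnu : frostman_class alpha nu.
  by exists 1%R => z r r0; rewrite mul1r; exact: nu1.
have c1 : 0 <= frostman_const alpha nu <= 1.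
  apply/andP; split.
    apply: (@le_trans _ _ ((1 `^ (- alpha))%:E * nu (eball1 (0%R, 0%R) 1%R))).
      by rewrite mule_ge0// lee_fin powR_ge0.
    by apply: ereal_sup_ubound; exists (0%R, 0%R), 1%R.
  apply: ge_ereal_sup => _ [z [r r0 ->]].
  apply: (@le_trans _ _ ((r `^ (- alpha))%:E * (r `^ alpha)%:E)).
    by rewrite lee_wpmul2l ?nu1// lee_fin powR_ge0.
  by rewrite -EFinM lee_fin powRN mulVf// gt_eqF// powR_gt0.
have q0 : (0 <= fine q^-1)%R.
  by apply: fine_ge0; rewrite inve_ge0 (le_trans _ q1).
have := HC _ nu ELp Fnu.
have H : (a * m `^ fine q^-1)%:E <=
    'N[nu]_q[spherical_average \1_E \_ domain].
  apply: (Lnorm_ge (F := F)) => //.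
    apply/(measurable_restrictT _ measurable_domain).
    exact: measurable_funTS.
  move=> z; rewrite FE => -[Dz /= az].
  by rewrite patchE mem_set.
move=> /(le_trans H) H2; rewrite -lee_fin; apply: (le_trans H2).
rewrite EFinM; apply: (@le_trans _ _
  (`|C|%:E * 1 * 'N[lebesgue_rV d]_p[EFin \o \1_E])).
  rewrite lee_wpmul2r// ?Lnorm_ge0//.
  apply: (@le_trans _ _ (`|C|%:E * frostman_const alpha nu `^ fine q^-1)).
    by rewrite lee_wpmul2r ?poweR_ge0// lee_fin ler_norm.
  rewrite lee_wpmul2l ?lee_fin//.
  rewrite -(poweR1r (fine q^-1)); case/andP: c1 => c0 c1.
  by apply: gt0_ler_poweR => //; rewrite in_itv/= ?leey ?andbT.
by rewrite mule1 lee_wpmul2l ?lee_fin//; exact: Lnorm_indic_le.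
Qed.

End spherical_test.

(** * Lower bounds for the surface measure *)

Section sphere_lower_bound.
Context {R : realType} {d : nat}.
Implicit Types x : 'rV[R]_d.

Lemma sqr_coord_le_enorm x i : x ord0 i ^+ 2 <= enorm x ^+ 2.
Proof.
rewrite sqr_sqrtr; last by apply: sumr_ge0 => j _; exact: sqr_ge0.
rewrite (bigD1 i)//= lerDl; apply: sumr_ge0 => j _; exact: sqr_ge0.
Qed.

Lemma coord_le_enorm x i : `|x ord0 i| <= enorm x.
Proof.
by rewrite -ler_sqr ?nnegrE ?sqrtr_ge0// real_normK ?num_real// sqr_coord_le_enorm.
Qed.

Lemma measurable_cone (B : set 'rV[R]_d) : measurable B -> measurable (cone B).
Proof.
move=> mB; apply: measurableI.
  by rewrite -[X in measurable X]setTI; exact: measurable_direction.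
rewrite (_ : mkset _ = enorm @^-1` `]0%R, 1%R[); last first.
  by apply/seteqP; split => x; rewrite /= in_itv.
by rewrite -[X in measurable X]setTI; exact: measurable_enorm.
Qed.

Lemma lebesgue_measure_ball_le (a r : R) : 0 <= r ->
  (lebesgue_measure [set s : R | `|s - a| <= r]%R <= (2 * r)%:E)%E.
Proof.
move=> r0; rewrite (_ : mkset _ = `[a - r, a + r]%classic); last first.
  by apply/seteqP; split=> s /=; rewrite in_itv/= ler_distl.
rewrite lebesgue_measure_itv /= lte_fin; case: ifPn => _.
  by rewrite -EFinB lee_fin; lra.
by rewrite lee_fin; lra.
Qed.

Lemma lebesgue_measure_ball_ge (a r : R) : 0 <= r ->
  ((2 * r)%:E <= lebesgue_measure [set s : R | `|s - a| <= r]%R)%E.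
Proof.
move=> r0; rewrite (_ : mkset _ = `[a - r, a + r]%classic); last first.
  by apply/seteqP; split=> s /=; rewrite in_itv/= ler_distl.
rewrite lebesgue_measure_itv /= lte_fin; case: ifPn => [_|].
  by rewrite -EFinB lee_fin; lra.
by rewrite -leNgt lee_fin; lra.
Qed.

(** The enclosing cube [-1, 1]^d bounds the volume that normalises the surface measure, and shows
    that it is finite. *)
Lemma lebesgue_unit_ball_le :
  (lebesgue_rV d (cone [set: 'rV[R]_d]) <= (2 ^+ d)%:E)%E.
Proof.
pose S (i : 'I_d) (z : 'rV[R]_d) := [set s : R | `|s - 0| <= 1].
have mS i : measurable [set z : 'rV[R]_d | S i z (z ord0 i)].
  rewrite (_ : mkset _ = (fun z : 'rV[R]_d => z ord0 i) @^-1` `[-1, 1]%classic).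
    by rewrite -[X in measurable X]setTI; exact: measurable_coord.
  by apply/seteqP; split=> s /=; rewrite /S/= in_itv/= subr0 ler_norml.
apply: (@le_trans _ _ (lebesgue_rV d [set z | forall i, S i z (z ord0 i)])).
  apply: le_measure; rewrite ?inE; first exact: measurable_cone.
    exact: measurable_forall.
  move=> x [_ /= /andP[_ x1]] i; rewrite /S/= subr0.
  by rewrite (le_trans (coord_le_enorm x i))// ltW.
have := @lebesgue_rV_triangular_le R d S (fun=> 2) mS.
rewrite prodr_const card_ord; apply => // i z.
by apply: (le_trans (lebesgue_measure_ball_le _ ler01)); rewrite mulr1.
Qed.

(** The factor [d] cancels and the measure of [B] is a quotient of volumes of cones, so a solid set
    [T] in the cone over [B] replaces any parametrisation of the sphere. The bound on [T] also keeps
    the total mass away from 0, where [mnormalize] would return its default. *)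
Lemma sphere_measure_ge (B T : set 'rV[R]_d) (k : R) : (0 < d)%N ->
  measurable B -> measurable T -> T `<=` cone B -> 0 < k ->
  (k%:E <= lebesgue_rV d T)%E -> ((k / 2 ^+ d)%:E <= sphere_measure B)%E.
Proof.
move=> d0 mB mT TB k0 kT.
have kB : (k%:E <= lebesgue_rV d (cone B))%E.
  by apply: (le_trans kT); apply: le_measure => //; rewrite inE //; exact: measurable_cone.
have BT : (lebesgue_rV d (cone B) <= lebesgue_rV d (cone [set: 'rV[R]_d]))%E.
  apply: le_measure; rewrite ?inE; try exact: measurable_cone.
  by apply: setSI.
have [v vE] : exists v : R, lebesgue_rV d (cone [set: 'rV[R]_d]) = v%:E.
  exists (fine (lebesgue_rV d (cone [set: 'rV[R]_d]))).
  rewrite fineK// ge0_fin_numE//.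
  by rewrite (le_lt_trans lebesgue_unit_ball_le)// ltry.
have v2 : v <= 2 ^+ d by rewrite -lee_fin -vE lebesgue_unit_ball_le.
have kv : k <= v by rewrite -lee_fin -vE (le_trans kB).
have v0 : 0 < v by rewrite (lt_le_trans k0).
have d0' : 0 < d%:R :> R by rewrite ltr0n.
rewrite /sphere_measure /mnormalize /=.
have -> : sphere_surface [set: 'rV[R]_d] = (d%:R * v)%:E.
  by rewrite /sphere_surface vE EFinM.
rewrite ifF; last by rewrite orbF eqe gt_eqF// mulr_gt0.
rewrite /sphere_surface /=.
apply: (@le_trans _ _ (d%:R%:E * k%:E * ((d%:R * v)^-1)%:E)%E).
  rewrite -!EFinM lee_fin invfM mulrA [d%:R * k]mulrC mulfK ?gt_eqF//.
  by rewrite ler_pM2l// lef_pV2// posrE// exprn_gt0.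
by rewrite lee_wpmul2r ?lee_fin ?invr_ge0 ?mulr_ge0 ?(ltW d0') ?(ltW v0)// lee_wpmul2l ?lee_fin ?ler0n.
Qed.

End sphere_lower_bound.

(** * Spheres through a plate *)

Section plate_geometry.
Context {R : realType} {d : nat}.
Implicit Types (x y z X : 'rV[R]_d) (i j : 'I_d) (delta eta t : R).

(* Any sufficiently small multiple of [1 / d] would do. *)
Definition c0 : R := (100 * 100 * d%:R)^-1.

(* The plate of index [j] is the [O(delta)]-neighbourhood of a cap of width
   [eta], around the point [y_j = - 3/2], of the (d - j - 1)-sphere of radius 3/2
   in the coordinates [k >= j]. *)
Definition plate_section j delta eta i y : set R :=
  if (i < j)%N then [set s | `|s| <= 600 * delta]
  else if (j < i)%N then [set s | `|s| <= eta]
  else [set s | -2 <= s <= -1 /\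
         `|9 / 4 - \sum_(k : 'I_d | (j < k)%N) y ord0 k ^+ 2 - s ^+ 2|
            <= 600 * delta].

Definition plate j delta eta : set 'rV[R]_d :=
  [set y | forall i, plate_section j delta eta i y (y ord0 i)].

(** For [z] of norm [L], coordinate [i < j] of [X - (t / L) z] vanishes when [z_i = X_i L / t]. In
    the tube [L / t] is close to [radius_from j z / (3 / 2 + X_j)]; this ratio involves only
    coordinates of index at least [j], which keeps the sections triangular. *)
Definition radius_from j z : R :=
  Num.sqrt (z ord0 j ^+ 2 + \sum_(k : 'I_d | (j < k)%N) z ord0 k ^+ 2).

(* The tube lies in the cone over the directions [y] such that [X - t y] is in
   the plate. *)
Definition tube_section X j delta eta i z : set R :=
  if (i < j)%N
  then [set s | `|s - X ord0 i * (radius_from j z / (3 / 2 + X ord0 j))| <= delta]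
  else if (j < i)%N then [set s | `|s - 0| <= c0 / 16 * eta]
  else [set s | `|s - 3 / 16| <= 1 / 16].

Definition tube X j delta eta : set 'rV[R]_d :=
  [set z | forall i, tube_section X j delta eta i z (z ord0 i)].

(* Up to [O(delta)], the sphere of centre [X] and radius [focal j X] passes
   through the plate: if only the first [j] coordinates of [X] are nonzero, it
   contains the (d - j - 1)-sphere of radius 3/2 orthogonal to them. *)
Definition focal j X : R :=
  Num.sqrt ((3 / 2 + X ord0 j) ^+ 2 +
            \sum_(k : 'I_d | (k < j)%N) X ord0 k ^+ 2).

(** With radius [3 / 2 + X_j], the spheres centred on axis [j] are tangent at the point [-3/2] of
    that axis and part by about [|X_j| eta^2] over a cap of width [eta]; a shift [v] of the centre
    along the cap costs about [|v| eta]. The tolerances keep both at [delta]. *)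
Definition near_focal j delta eta X t : Prop :=
  [/\ forall i, (i < j)%N -> `|X ord0 i| <= c0,
      forall i, (j < i)%N -> `|X ord0 i| <= delta / eta,
      `|X ord0 j| <= delta / eta ^+ 2 &
      `|t - focal j X| <= delta].

Lemma sum_split3 j (f : 'I_d -> R) :
  \sum_i f i = \sum_(i : 'I_d | (i < j)%N) f i + f j + \sum_(i : 'I_d | (j < i)%N) f i.
Proof.
rewrite (bigID (fun i : 'I_d => (i < j)%N)) /= -addrA; congr (_ + _).
rewrite (bigD1 j) ?ltnn//=; congr (_ + _); apply: eq_bigl => i.
by rewrite -leqNgt andbC -val_eqE /= eq_sym ltn_neqAle.
Qed.

Lemma ler_sum_const (P : pred 'I_d) (f : 'I_d -> R) b : 0 <= b ->
  (forall i, P i -> `|f i| <= b) -> `|\sum_(i | P i) f i| <= d%:R * b.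
Proof.
move=> b0 fb; apply: (le_trans (ler_norm_sum _ _ _)).
apply: (@le_trans _ _ (\sum_(i | P i) b)); first exact: ler_sum.
rewrite sumr_const -[leLHS]mulr_natl ler_wpM2r// ler_nat.
by rewrite (leq_trans (max_card _))// card_ord.
Qed.

Lemma c0_gt0 : (0 < d)%N -> 0 < c0.
Proof.
rewrite -(ltr0n R) => d0; rewrite invr_gt0 pmulr_rgt0 ?d0//; lra.
Qed.

Lemma c0_dim : (0 < d)%N -> d%:R * c0 = 1 / (100 * 100).
Proof.
rewrite -(ltr0n R) => d0; rewrite /c0; field.
exact: lt0r_neq0.
Qed.

Lemma c0_le : (0 < d)%N -> c0 <= 1 / (100 * 100).
Proof.
move=> d0; rewrite -(c0_dim d0) ler_peMl ?(ltW (c0_gt0 d0))//.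
by rewrite ler1n.
Qed.

(* If [L^2 = r^2 + s] and [s] is within [delta] of [W r^2 / rho'^2], the sphere
   of radius [t = sqrt (rho'^2 + W) + O(delta)] rescales [r] to [rho' + O(delta)]. *)
Lemma rescaled_radius (rho' W r s L t T0 delta : R) :
  0 <= delta -> delta <= 1 / (100 * 100) -> 0 <= W -> W <= 1 / (100 * 100) ->
  7 / 5 <= rho' <= 8 / 5 -> 1 / 8 <= r <= 1 / 2 -> 0 <= s ->
  0 <= T0 -> T0 ^+ 2 = rho' ^+ 2 + W -> `|t - T0| <= delta ->
  0 <= L -> L ^+ 2 = r ^+ 2 + s ->
  `|s - W * (r / rho') ^+ 2| <= delta ->
  [/\ 1 / 8 <= L, 0 < t / L, t / L <= 16 & `|t / L * r - rho'| <= 56 * delta].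
Proof.
move=> de0 de1 W0 W1 /andP[rho1 rho2] /andP[r1 r2] s0 T00 T0E tT L0 LE sE.
have rho0 : 0 < rho' by lra.
have L1 : 1 / 8 <= L by nra.
have T1 : rho' <= T0 by nra.
have T2 : T0 <= 17 / 10 by nra.
have t0 : 0 < t by move: tT; rewrite ler_distl => /andP[]; lra.
have t2 : t <= 2 by move: tT; rewrite ler_distl => /andP[]; lra.
have Lp : 0 < L by lra.
(* The square of [r * T0 / rho'] is [r^2 + W (r / rho')^2], so the difference of squares is exactly
   the error in [s]; the sum of the two lengths is at least 1/4. *)
have HL : `|L - r * T0 / rho'| <= 4 * delta.
  have q1 : 1 / 8 <= r * T0 / rho'.
    by rewrite ler_pdivlMr//; nra.
  have E : (L - r * T0 / rho') * (L + r * T0 / rho') = s - W * (r / rho') ^+ 2.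
    rewrite -subr_sqr LE !exprMn T0E exprVn; field.
    by rewrite gt_eqF.
  have : `|L - r * T0 / rho'| * (L + r * T0 / rho') <= delta.
    rewrite -[X in _ * X]ger0_norm; last by lra.
    by rewrite -normrM E.
  have := normr_ge0 (L - r * T0 / rho'); nra.
split=> //; first exact: divr_gt0.
  by rewrite ler_pdivrMr//; lra.
have -> : t / L * r - rho' = (t * r - rho' * L) / L.
  by field; rewrite gt_eqF.
rewrite normrM normfV (gtr0_norm Lp) ler_pdivrMr//.
have : `|t * r - rho' * L| <= 7 * delta.
  have -> : t * r - rho' * L = r * (t - T0) - rho' * (L - r * T0 / rho').
    by field; rewrite gt_eqF.
  apply: (le_trans (ler_normB _ _)); rewrite !normrM.
  rewrite (gtr0_norm rho0) (_ : `|r| = r); last by rewrite ger0_norm//; lra.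
  have := normr_ge0 (L - r * T0 / rho'); have := normr_ge0 (t - T0); nra.
nra.
Qed.

(** Expanding, [9/4 - Q - Y^2 = 2 Xj (Y - 3/2) + V - 2 P] up to the error of [S]. Since
    [|Y - 3/2| <= eta^2] on the cap, the first term stays below [2 delta] although [Xj] may be as
    large as [delta / eta^2]. The errors add up to [565 delta], which the 600 in the plates
    covers. *)
Lemma cap_defect (Xj Y Q V P S delta eta : R) :
  0 < delta -> 0 < eta <= 1 -> delta <= 1 / (100 * 100) * eta ^+ 2 ->
  `|Xj| <= delta / eta ^+ 2 -> 0 <= Q <= eta ^+ 2 / 64 -> `|V| <= delta ->
  `|P| <= delta -> `|S - (3 / 2 + Xj) ^+ 2| <= 560 * delta -> 0 < Xj + Y ->
  S = (Xj + Y) ^+ 2 + V - 2 * P + Q ->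
  1 <= Y <= 2 /\ `|9 / 4 - Q - Y ^+ 2| <= 600 * delta.
Proof.
move=> de0 /andP[e0 e1] dee; set u := delta / _ => Xu /andP[Q0 Q1] V1 P1 S1 XY SE.
have e2 : 0 < eta ^+ 2 by rewrite exprn_gt0.
have e21 : eta ^+ 2 <= 1 by rewrite expr_le1// ltW.
have due : delta = u * eta ^+ 2 by rewrite /u divfK// gt_eqF.
have u0 : 0 < u by rewrite divr_gt0.
have u1 : u <= 1 / (100 * 100) by rewrite ler_pdivrMr.
move: e2 e21 dee Q1 due; set w := eta ^+ 2 => e2 e21 dee Q1 due.
move: Xu V1 P1 S1; rewrite !ler_norml SE => /andP[X1 X2] /andP[V1 V2] /andP[P1 P2] /andP[S1 S2].
have Y1 : 1 <= Y by nra.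
have Y2 : Y <= 2 by nra.
have D1 : Y - 3 / 2 <= w by nra.
have D2 : - w <= Y - 3 / 2 by nra.
split; first by rewrite Y1 Y2.
have : `|Xj * (Y - 3 / 2)| <= delta.
  by rewrite normrM due ler_pM// ler_norml ?X1 ?D2.
rewrite ler_norml => /andP[M1 M2].
by apply/andP; split; lra.
Qed.

End plate_geometry.

Section tube_plate.
Context {R : realType} {d : nat}.
Implicit Types (x y z X : 'rV[R]_d) (i j : 'I_d) (delta eta t : R).

Lemma tube_plate j delta eta X t z : 0 < eta <= 1 -> 0 < delta ->
  delta <= @c0 R d * eta ^+ 2 -> near_focal j delta eta X t ->
  tube X j delta eta z ->
  0 < enorm z < 1 /\ plate j delta eta (X - t *: direction z).
Proof.
move=> e01 de0 dee [Xw Xv Xj tT] Tz; rewrite /focal in tT.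
have d0 : (0 < d)%N by case: (j) => m; exact: leq_ltn_trans.
have c00 := @c0_gt0 R d d0; have c01 := @c0_le R d d0; have dc := @c0_dim R d d0.
move: c00 c01 dc Xw dee Tz; rewrite /tube /tube_section.
set c := @c0 R d => c00 c01 dc Xw dee Tz.
have [e0 e1] := andP e01.
have e2 : 0 < eta ^+ 2 by rewrite exprn_gt0.
have e21 : eta ^+ 2 <= 1 by rewrite expr_le1// ltW.
have D0 : 0 <= d%:R :> R by exact: ler0n.
have dc1 : delta <= c by nra.
have u1 : delta / eta ^+ 2 <= c by rewrite ler_pdivrMr.
have u0 : 0 < delta / eta ^+ 2 by rewrite divr_gt0.
have v1 : delta / eta <= c * eta by rewrite ler_pdivrMr// -mulrA -expr2.
have v0 : 0 < delta / eta by rewrite divr_gt0.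
have zw i : (i < j)%N ->
    `|z ord0 i - X ord0 i * (radius_from j z / (3 / 2 + X ord0 j))| <= delta.
  by move=> ij; have := Tz i; rewrite ij.
have zv i : (j < i)%N -> `|z ord0 i| <= c / 16 * eta.
  by move=> ij; have := Tz i; rewrite ltnNge (ltnW ij) ij /= subr0.
have zj : `|z ord0 j - 3 / 16| <= 1 / 16 by have := Tz j; rewrite !ltnn.
move: zw; set r := radius_from j z; set rho := 3 / 2 + X ord0 j => zw.
set v := \sum_(k : 'I_d | (j < k)%N) z ord0 k ^+ 2.
set s := \sum_(k : 'I_d | (k < j)%N) z ord0 k ^+ 2.
set W := \sum_(k : 'I_d | (k < j)%N) X ord0 k ^+ 2 in tT.
have v_0 : 0 <= v by apply: sumr_ge0 => k _; exact: sqr_ge0.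
have s_0 : 0 <= s by apply: sumr_ge0 => k _; exact: sqr_ge0.
have W_0 : 0 <= W by apply: sumr_ge0 => k _; exact: sqr_ge0.
have sqb (a b : R) : `|a| <= b -> `|a ^+ 2| <= b ^+ 2.
  by move=> ab; rewrite normrX lerXn2r// nnegrE (le_trans _ ab).
have vb : v <= c.
  have : `|v| <= d%:R * (c / 16 * eta) ^+ 2.
    apply: ler_sum_const; first exact: sqr_ge0.
    by move=> i ji; exact/sqb/zv.
  rewrite ger0_norm// (_ : d%:R * _ = (d%:R * c) * (c * eta ^+ 2) / 256); last by field.
  rewrite dc; nra.
have Wb : W <= 1 / (100 * 100).
  have : `|W| <= d%:R * c ^+ 2.
    apply: ler_sum_const; first exact: sqr_ge0.
    by move=> i ji; exact/sqb/Xw.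
  rewrite ger0_norm// (_ : d%:R * _ = (d%:R * c) * c); last by ring.
  rewrite dc; nra.
have r2 : r ^+ 2 = z ord0 j ^+ 2 + v.
  by rewrite sqr_sqrtr// addr_ge0// sqr_ge0.
have r0 : 0 <= r by exact: sqrtr_ge0.
move: (zj); rewrite ler_norml => /andP[zj1 zj2].
have r1 : 1 / 8 <= r <= 1 / 2 by apply/andP; split; nra.
have [rl rh] := andP r1.
have rho1 : 7 / 5 <= rho <= 8 / 5.
  by move: (le_trans Xj u1); rewrite /rho ler_norml => /andP[? ?]; apply/andP; split; lra.
have rho0 : 0 < rho by case/andP: rho1; lra.
have rr : 0 <= r / rho <= 1.
  by rewrite divr_ge0 ?(ltW rho0)//= ler_pdivrMr//; case/andP: rho1; lra.
(* Below [j] the coordinates of [z] follow those of [X] scaled by [r / rho], up to [delta]; the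
   smallness of [d * c0] absorbs the number of terms. *)
have sW : `|s - W * (r / rho) ^+ 2| <= delta.
  have -> : s - W * (r / rho) ^+ 2 = \sum_(k : 'I_d | (k < j)%N)
      (z ord0 k ^+ 2 - (X ord0 k * (r / rho)) ^+ 2).
    rewrite sumrB /s /W mulr_suml; congr (_ - _); apply: eq_bigr => k _.
    by rewrite [RHS]exprMn.
  apply: (@le_trans _ _ (d%:R * (3 * c * delta))).
    apply: ler_sum_const; first by nra.
    move=> k kj; have zk := zw _ kj; have Xk := Xw _ kj.
    rewrite subr_sqr normrM [leLHS]mulrC.
    rewrite ler_pM//.
    apply: (@le_trans _ _ (`|z ord0 k - X ord0 k * (r / rho)| +
                           2 * `|X ord0 k * (r / rho)|)).
      move: (X ord0 k * (r / rho)) => A.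
      have -> : z ord0 k + A = z ord0 k - A + (A + A) by ring.
      apply: (le_trans (ler_normD _ _)); rewrite lerD2l.
      by apply: (le_trans (ler_normD _ _)); rewrite mulr_natl mulr2n.
    rewrite normrM [ `|r / rho|]ger0_norm; last by case/andP: rr.
    case/andP: rr => rr0 rr1; have := normr_ge0 (X ord0 k); nra.
  rewrite (_ : d%:R * _ = (d%:R * c) * (3 * delta)); last by ring.
  rewrite dc; lra.
set L := enorm z.
have L0 : 0 <= L by exact: sqrtr_ge0.
have L2 : L ^+ 2 = r ^+ 2 + s.
  rewrite sqr_sqrtr; last by apply: sumr_ge0 => k _; exact: sqr_ge0.
  by rewrite (sum_split3 j) r2 -/s -/v; ring.
have de1 : delta <= 1 / (100 * 100) by lra.
have T00 := sqrtr_ge0 (rho ^+ 2 + W).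
have T02 : Num.sqrt (rho ^+ 2 + W) ^+ 2 = rho ^+ 2 + W.
  by rewrite sqr_sqrtr// addr_ge0// sqr_ge0.
have [L1 tau0 tau1 tau2] := rescaled_radius (ltW de0) de1 W_0 Wb rho1 r1 s_0
  T00 T02 tT L0 L2 sW.
set tau := t / L in tau0 tau1 tau2.
have L3 : L < 1.
  have sb : s <= 1 / 100.
    move: sW; rewrite ler_norml => /andP[_ sW].
    have : (r / rho) ^+ 2 <= 1 by case/andP: rr => *; rewrite expr_le1.
    by move: (_ ^+ 2) sW => w; nra.
  nra.
split; first by rewrite L3 andbT; lra.
set y := X - _.
have yE i : y ord0 i = X ord0 i - tau * z ord0 i.
  by rewrite /y !mxE /tau mulrA.
have yv i : (j < i)%N -> `|y ord0 i| <= 2 * c * eta.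
  move=> ji; rewrite yE; apply: (le_trans (ler_normB _ _)).
  rewrite normrM (gtr0_norm tau0); have := zv _ ji; have := Xv _ ji.
  have := normr_ge0 (z ord0 i); nra.
move: Xj; rewrite -/rho => Xj.
have rhoE : rho = 3 / 2 + X ord0 j by [].
clearbody tau rho r L y.
clear tT T00 T02 sW rr rl rh L0 L1 L2 L3 Wb vb W_0 s_0 v_0.
move=> i; rewrite /plate_section.
case: ltnP => ij /=.
  (* Both terms are errors: that of the rescaled radius against [rho], and the distance of [z_i]
     from the centre of its section. *)
  have -> : y ord0 i = - X ord0 i * ((tau * r - rho) / rho)
      - tau * (z ord0 i - X ord0 i * (r / rho)).
    by rewrite yE; field; rewrite gt_eqF.
  apply: (le_trans (ler_normB _ _)); rewrite !normrM normrN normfV.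
  rewrite (gtr0_norm tau0) (gtr0_norm rho0).
  have Xi := Xw _ ij; have zi := zw _ ij.
  have : `|tau * r - rho| / rho <= 56 * delta.
    by rewrite ler_pdivrMr//; case/andP: rho1 => *; nra.
  have : 0 <= `|tau * r - rho| / rho by rewrite divr_ge0// ltW.
  move: (_ / rho) => g g0 g1.
  have := normr_ge0 (X ord0 i); have := normr_ge0 (z ord0 i - X ord0 i * (r / rho)).
  nra.
case: ltnP => ji /=.
  by apply: (le_trans (yv _ ji)); nra.
have -> : i = j by apply/val_inj/eqP; rewrite eqn_leq ij ji.
set Q := \sum_(_ | _) _.
set V := \sum_(k : 'I_d | (j < k)%N) X ord0 k ^+ 2.
set P := \sum_(k : 'I_d | (j < k)%N) X ord0 k * y ord0 k.
have Vb : `|V| <= delta.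
  apply: (@le_trans _ _ (d%:R * (delta / eta) ^+ 2)).
    apply: ler_sum_const; first exact: sqr_ge0.
    by move=> k jk; exact/sqb/Xv.
  rewrite (_ : d%:R * _ = d%:R * (delta / eta ^+ 2) * delta); last first.
    by field; rewrite gt_eqF.
  have : d%:R * (delta / eta ^+ 2) <= d%:R * c by rewrite ler_wpM2l.
  rewrite dc; nra.
have Pb : `|P| <= delta.
  apply: (@le_trans _ _ (d%:R * ((delta / eta) * (2 * c * eta)))).
    apply: ler_sum_const; first by nra.
    by move=> k jk; rewrite normrM ler_pM// ?Xv// yv.
  rewrite (_ : d%:R * _ = d%:R * c * (2 * delta)); last first.
    by field; rewrite gt_eqF.
  rewrite dc; nra.
have Qb : 0 <= Q <= eta ^+ 2 / 64.
  rewrite sumr_ge0 /=; last by move=> k _; exact: sqr_ge0.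
  apply: (le_trans (ler_norm _)).
  apply: (@le_trans _ _ (d%:R * (2 * c * eta) ^+ 2)).
    apply: ler_sum_const; first exact: sqr_ge0.
    by move=> k jk; exact/sqb/yv.
  rewrite (_ : d%:R * _ = d%:R * c * (4 * c * eta ^+ 2)); last by ring.
  rewrite dc; nra.
(* The factor 560 is the 56 of [rescaled_radius] times the bound 10 for [tau * r + rho]. *)
have Sb : `|(tau * r) ^+ 2 - rho ^+ 2| <= 560 * delta.
  rewrite subr_sqr normrM.
  have : 0 <= tau * r + rho by rewrite addr_ge0 ?mulr_ge0 ?(ltW rho0) ?(ltW tau0).
  have : tau * r + rho <= 10 by case/andP: rho1 => *; nra.
  move=> h1 h0; rewrite (ger0_norm h0).
  have := normr_ge0 (tau * r - rho); nra.
have XY : X ord0 j + - y ord0 j = tau * z ord0 j by rewrite yE; ring.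
have XYgt0 : 0 < X ord0 j + - y ord0 j by rewrite XY mulr_gt0//; lra.
(* [tau * r] is the length of [X - y] in the coordinates from [j] on; its square is expanded. *)
have SE : (tau * r) ^+ 2 = (X ord0 j + - y ord0 j) ^+ 2 + V - 2 * P + Q.
  rewrite XY exprMn r2 mulrDr -exprMn -!addrA; congr (_ + _).
  rewrite /V /P /Q !mulr_sumr -sumrN -!big_split /=; apply: eq_bigr => k _.
  by rewrite yE; ring.
have dee' : delta <= 1 / (100 * 100) * eta ^+ 2 by nra.
rewrite rhoE in Sb.
have [/andP[Y1 Y2] H] := cap_defect de0 e01 dee' Xj Qb Vb Pb Sb XYgt0 SE.
split; last by rewrite -[y ord0 j ^+ 2]sqrrN.
by apply/andP; split; lra.
Qed.

End tube_plate.

Section plate_measure.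
Context {R : realType} {d : nat}.
Implicit Types (x y z X : 'rV[R]_d) (i j : 'I_d) (delta eta t : R).

Lemma prod_split3 j (a b c : R) :
  \prod_(i < d) (if (i < j)%N then a else if (j < i)%N then b else c) =
  a ^+ j * b ^+ (d.-1 - j) * c.
Proof.
have jd := ltn_ord j.
rewrite -(big_mkord xpredT (fun i : nat => if (i < j)%N then a else if (j < i)%N then b else c)).
rewrite (@big_cat_nat _ _ _ j)//=; last exact: ltnW.
rewrite -mulrA; congr (_ * _).
  rewrite (eq_big_nat _ _ (F2 := fun=> a)); last by move=> i /andP[_ ->].
  by rewrite prodr_const_nat subn0.
rewrite big_ltn// !ltnn mulrC; congr (_ * _).
rewrite (eq_big_nat _ _ (F2 := fun=> b)).
  by rewrite prodr_const_nat; congr (_ ^+ _); lia.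
by move=> i /andP[ji _]; rewrite ji ltnNge (ltnW ji).
Qed.

Lemma measurable_sum_sqr (P : pred 'I_d) :
  measurable_fun [set: 'rV[R]_d] (fun z => \sum_(k | P k) z ord0 k ^+ 2).
Proof.
under eq_fun do rewrite big_mkcond /=.
apply: measurable_sum => i; case: (P i); last exact: measurable_cst.
exact: measurable_funX (measurable_coord i).
Qed.

Lemma measurable_set_ler (f g : 'rV[R]_d -> R) :
  measurable_fun setT f -> measurable_fun setT g ->
  measurable [set z | f z <= g z].
Proof. by move=> mf mg; rewrite -[X in measurable X]setTI; exact: measurable_fun_le. Qed.

Lemma measurable_radius_from j :
  measurable_fun [set: 'rV[R]_d] (radius_from j).
Proof.
apply: (@measurableT_comp _ _ _ _ _ _ (@Num.sqrt R)).
  exact: continuous_measurable_fun (@sqrt_continuous R).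
apply: measurable_funD; last exact: measurable_sum_sqr.
exact: measurable_funX (measurable_coord j).
Qed.

Lemma measurable_norm_sub (f g : 'rV[R]_d -> R) :
  measurable_fun setT f -> measurable_fun setT g ->
  measurable_fun setT (fun z => `|f z - g z|).
Proof. by move=> mf mg; apply: measurableT_comp => //; exact: measurable_funB. Qed.

Lemma measurable_tube_section X j delta eta i :
  measurable [set z : 'rV[R]_d | tube_section X j delta eta i z (z ord0 i)].
Proof.
have mc := @measurable_coord R d i.
rewrite /tube_section; case: (i < j)%N.
  exact: (measurable_set_ler (measurable_norm_sub mc
    (measurable_funM (measurable_cst (X ord0 i))
      (measurable_funM (measurable_radius_from j)
        (measurable_cst (3 / 2 + X ord0 j)^-1)))) (measurable_cst delta)).
case: (j < i)%N.
  exact: (measurable_set_ler (measurable_norm_sub mc (measurable_cst (0 : R)))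
    (measurable_cst (@c0 R d / 16 * eta))).
exact: (measurable_set_ler (measurable_norm_sub mc (measurable_cst (3 / 16 : R)))
  (measurable_cst (1 / 16 : R))).
Qed.

Lemma tube_section_tail X j delta eta i z z' s :
  (forall k : 'I_d, (i < k)%N -> z ord0 k = z' ord0 k) ->
  tube_section X j delta eta i z s -> tube_section X j delta eta i z' s.
Proof.
move=> zz'; rewrite /tube_section; case: ltnP => // ij.
rewrite (_ : radius_from j z = radius_from j z')// /radius_from zz'//.
congr (Num.sqrt (_ + _)); apply: eq_bigr => k jk; rewrite zz'//.
exact: ltn_trans jk.
Qed.

Lemma lebesgue_tube_ge X j delta eta : 0 <= delta -> 0 <= eta ->
  (((2 * delta) ^+ j * (2 * (@c0 R d / 16 * eta)) ^+ (d.-1 - j) * (2 * (1 / 16)))%:E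
    <= lebesgue_rV d (tube X j delta eta))%E.
Proof.
move=> de0 e0; rewrite -prod_split3.
have c00 : 0 <= @c0 R d by rewrite invr_ge0 !mulr_ge0.
have ce : 0 <= @c0 R d / 16 * eta by rewrite mulr_ge0 ?divr_ge0.
apply: lebesgue_rV_triangular_ge.
- exact: measurable_tube_section.
- by move=> i z z' r; exact: tube_section_tail.
- by move=> i; case: ifP => _; [|case: ifP => _]; apply: mulr_ge0; rewrite // divr_ge0.
- move=> i z; rewrite /tube_section; case: ifP => _; [|case: ifP => _];
  by apply: lebesgue_measure_ball_ge; rewrite ?divr_ge0.
Qed.

(** Each of the [d] sides of the tube is at least [c0 / 8] times its scale [delta], [eta] or 1, and
    [2 ^+ d] bounds the normalising volume. *)
Definition avg_const : R := (@c0 R d / 8) ^+ d / 2 ^+ d.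

Lemma avg_const_gt0 : (0 < d)%N -> 0 < avg_const.
Proof.
by move=> d0; rewrite /avg_const divr_gt0 ?exprn_gt0 ?divr_gt0 ?c0_gt0.
Qed.

(** The plate is thin in [j + 1] directions, one of them nearly normal to the sphere; the sphere
    meets it in a piece of size about [delta^j * eta^(d - 1 - j)]. The translation [y0] prepares for
    unions of plates. *)
Lemma sphere_measure_plate j delta eta (E : set 'rV[R]_d) x y0 t :
  0 < eta <= 1 -> 0 < delta -> delta <= @c0 R d * eta ^+ 2 -> measurable E ->
  (forall y, plate j delta eta y -> E (y0 + y)) ->
  near_focal j delta eta (x - y0) t ->
  ((avg_const * (delta ^+ j * eta ^+ (d.-1 - j)))%:E <=
    sphere_measure [set y | E (x - t *: y)%R])%E.
Proof.
move=> e01 de0 dee mE plE nf.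
have d0 : (0 < d)%N by case: (j) => m; exact: leq_ltn_trans.
have [e0 _] := andP e01.
have c00 := @c0_gt0 R d d0; have c01 := @c0_le R d d0.
have mB : measurable [set y | E (x - t *: y)].
  have m1 : measurable_fun setT (fun y : 'rV[R]_d => x - t *: y).
    exact: (measurableT_comp measurable_sphere_point (pair1_measurable (x, t))).
  by rewrite -[X in measurable X]setTI; exact: m1.
have mT : measurable (tube (x - y0) j delta eta).
  by apply: measurable_forall => i; exact: measurable_tube_section.
rewrite /avg_const mulrAC; apply: sphere_measure_ge mB mT _ _ _ => //.
- move=> z Tz; have [z1 Pz] := tube_plate e01 de0 dee nf Tz.
  split => //=; have := plE _ Pz.
  by rewrite addrA addrCA subrr addr0.
- by rewrite !mulr_gt0 ?exprn_gt0 ?divr_gt0.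
- apply: le_trans (lebesgue_tube_ge _ j (ltW de0) (ltW e0)).
  rewrite lee_fin.
  have -> : (@c0 R d / 8) ^+ d =
      (@c0 R d / 8) ^+ j * (@c0 R d / 8) ^+ (d.-1 - j) * (@c0 R d / 8).
    by rewrite -exprD -exprSr; congr (_ ^+ _); have := ltn_ord j; lia.
  set c := @c0 R d in c00 c01 *.
  have -> : (c / 8) ^+ j * (c / 8) ^+ (d.-1 - j) * (c / 8) *
      (delta ^+ j * eta ^+ (d.-1 - j)) =
      (c / 8 * delta) ^+ j * (c / 8 * eta) ^+ (d.-1 - j) * (c / 8).
    by rewrite !exprMn; ring.
  have c8 : 0 <= c / 8 by rewrite divr_ge0// ltW.
  have cde : 0 <= c / 8 * delta by rewrite mulr_ge0// ltW.
  have ce : 0 <= c / 8 * eta by rewrite mulr_ge0// ltW.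
  have H1 : c / 8 * delta <= 2 * delta by nra.
  have H2 : c / 8 * eta <= 2 * (c / 16 * eta) by lra.
  apply: ler_pM => //; last by lra.
    by rewrite mulr_ge0 ?exprn_ge0.
  apply: ler_pM; rewrite ?exprn_ge0//.
    by apply: lerXn2r; rewrite ?nnegrE// (le_trans _ H1).
  by apply: lerXn2r; rewrite ?nnegrE// (le_trans _ H2).
Qed.

Definition translated_plate y0 j delta eta : set 'rV[R]_d :=
  [set y | forall i, plate_section j delta eta i (y - y0) (y ord0 i - y0 ord0 i)].

Lemma measurable_plate_section y0 j delta eta i : measurable
  [set y : 'rV[R]_d | plate_section j delta eta i (y - y0) (y ord0 i - y0 ord0 i)].
Proof.
have mc k : measurable_fun setT (fun y : 'rV[R]_d => y ord0 k - y0 ord0 k).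
  by apply: measurable_funB; [exact: measurable_coord|exact: measurable_cst].
have mn k : measurable_fun setT (fun y : 'rV[R]_d => `|y ord0 k - y0 ord0 k|).
  exact: measurableT_comp.
rewrite /plate_section; case: (i < j)%N.
  exact: (measurable_set_ler (mn i) (measurable_cst (600 * delta))).
case: (j < i)%N; first exact: (measurable_set_ler (mn i) (measurable_cst eta)).
rewrite (_ : mkset _ =
  [set y : 'rV[R]_d | -2 <= y ord0 i - y0 ord0 i] `&`
  [set y : 'rV[R]_d | y ord0 i - y0 ord0 i <= -1] `&`
  [set y : 'rV[R]_d | `|9 / 4 - \sum_(k : 'I_d | (j < k)%N) (y - y0) ord0 k ^+ 2
            - (y ord0 i - y0 ord0 i) ^+ 2| <= 600 * delta]); last first.
  by apply/seteqP; split => y /= [] => [/andP[]|[]] *; do ?split; rewrite //; apply/andP.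
apply: measurableI; first apply: measurableI.
- by apply: measurable_set_ler => //; exact: measurable_cst.
- by apply: measurable_set_ler => //; exact: measurable_cst.
- apply: measurable_set_ler; last exact: measurable_cst.
  apply: measurable_norm_sub; last exact: measurable_funX.
  apply: measurable_funB; first exact: measurable_cst.
  apply: (measurableT_comp (@measurable_sum_sqr (fun k => (j < k)%N))).
  by apply: measurable_fun_rV => k; under eq_fun do rewrite !mxE; exact: mc.
Qed.

Lemma measurable_translated_plate y0 j delta eta :
  measurable (translated_plate y0 j delta eta).
Proof. by apply: measurable_forall => i; exact: measurable_plate_section. Qed.

Lemma translated_plateP y0 j delta eta y :
  plate j delta eta y -> translated_plate y0 j delta eta (y0 + y).
Proof.
move=> Py i; rewrite addrAC subrr add0r mxE addrAC subrr add0r; exact: Py.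
Qed.

Lemma lebesgue_translated_plate_le y0 j delta eta : 0 <= delta -> 0 <= eta ->
  (lebesgue_rV d (translated_plate y0 j delta eta) <=
   ((2 * (600 * delta)) ^+ j * (2 * eta) ^+ (d.-1 - j) * (2 * (600 * delta)))%:E)%E.
Proof.
move=> de0 e0; rewrite -prod_split3.
have h6 : 0 <= 600 * delta by lra.
have h12 : 0 <= 2 * (600 * delta) by lra.
apply: (@lebesgue_rV_triangular_le R d (fun i z =>
  [set s | plate_section j delta eta i (z - y0) (s - y0 ord0 i)])).
- exact: measurable_plate_section.
- move=> i z z' r zz'; rewrite /plate_section; case: ifP => // _; case: ifP => // ji.
  move: (zz') ji => {}zz' /negbT; rewrite -leqNgt => ij.
  move=> /= [H1 H2]; split=> //; move: H2; congr (`|_ - _ - _| <= _).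
  apply: eq_bigr => k jk; rewrite !mxE zz'//.
  exact: leq_ltn_trans jk.
- by move=> i; case: ifP => _; [|case: ifP => _]; rewrite ?h12// mulr_ge0.
- move=> i z; rewrite /plate_section; set z0 := y0 ord0 i; case: ifP => _; [|case: ifP => _].
  + exact: lebesgue_measure_ball_le.
  + exact: lebesgue_measure_ball_le.
  + set A := (X in lebesgue_measure X).
    (* On [-2, -1] the square has slope at least 2 in absolute value, so the section lies within
       [600 * delta] of any one of its points. *)
    have [->|/set0P[s As]] := eqVneq A set0.
      by rewrite measure0 lee_fin.
    apply: le_trans (@lebesgue_measure_ball_le R s (600 * delta) h6).
    apply: le_outer_measure => u; move: As; rewrite /A /=.
    move: (9 / 4 - _) => q [s12 sq] [u12 uq].
    rewrite (_ : u - s = (u - z0) - (s - z0)); last by ring.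
    move: (s - z0) (u - z0) s12 sq u12 uq => a b /andP[a1 a2] aq /andP[b1 b2] bq.
    have : `|b - a| * `|b + a| <= 1200 * delta.
      rewrite -normrM -subr_sqr (_ : b ^+ 2 - a ^+ 2 = (q - a ^+ 2) - (q - b ^+ 2)); last by ring.
      by apply: (le_trans (ler_normB _ _)); lra.
    have -> : `|b + a| = - (b + a) by rewrite ler0_norm//; lra.
    have := normr_ge0 (b - a); nra.
Qed.

End plate_measure.

(** * Frostman bounds for intervals and progressions *)

Section frostman_products.
Context {R : realType}.
Implicit Types (rho theta a w : R).

Definition interval_set a r : set R := [set s : R | `|s - a| <= r].

Lemma measurable_interval_set a r : measurable (interval_set a r).
Proof.
rewrite (_ : interval_set a r = `[a - r, a + r]%classic).
  exact: measurable_itv.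
by apply/seteqP; split=> s /=; rewrite /interval_set /= in_itv/= ler_distl.
Qed.

(* Bounding each side of a box by this interpolation, with exponents [theta] of
   sum [alpha], gives the Frostman condition at all scales at once. *)
Lemma min_le_interpolation (h rho theta : R) : 0 < h -> 0 < rho ->
  0 <= theta <= 1 -> Num.min h rho <= h `^ (1 - theta) * rho `^ theta.
Proof.
move=> h0 r0 /andP[t0 t1].
rewrite ge_min; have [hr|rh] := leP h rho.
  apply/orP; left; rewrite -{1}(powRr1 (ltW h0)) -{1}(subrK theta 1) powRD.
    rewrite ler_wpM2l ?powR_ge0// ge0_ler_powR ?nnegrE// ltW//.
  by rewrite (gt_eqF h0) implybT.
apply/orP; right; rewrite -{1}(powRr1 (ltW r0)) -{1}(subrK theta 1) powRD.
  by rewrite ler_wpM2r ?powR_ge0// ge0_ler_powR ?nnegrE ?subr_ge0// ltW.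
by rewrite (gt_eqF r0) implybT.
Qed.

Lemma lebesgue_interval_cap c a h rho theta : 0 < h -> 0 < rho ->
  0 <= theta <= 1 ->
  (lebesgue_measure (interval_set c h `&` interval_set a rho) <=
   (2 * h `^ (1 - theta) * rho `^ theta)%:E)%E.
Proof.
move=> h0 r0 th.
apply: (@le_trans _ _ (2 * Num.min h rho)%:E); last first.
  by rewrite lee_fin -mulrA ler_pM2l// min_le_interpolation.
rewrite minEle; case: ifP => _.
  apply: le_trans (lebesgue_measure_ball_le c (ltW h0)).
  by apply: le_outer_measure => s [].
apply: le_trans (lebesgue_measure_ball_le a (ltW r0)).
by apply: le_outer_measure => s [].
Qed.

(* For [N ~ w^-beta], [sigma ~ w^beta] and [r ~ w], this set looks
   [beta]-dimensional at the scales between [w] and 1. *)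
Definition progression (N : nat) (sigma r : R) : set R :=
  [set s | exists2 i : nat, (i < N)%N & interval_set (i%:R * sigma) r s].

Lemma progressionS N sigma r : progression N.+1 sigma r =
  progression N sigma r `|` interval_set (N%:R * sigma) r.
Proof.
apply/seteqP; split=> s.
  move=> [i]; rewrite ltnS leq_eqVlt => /orP[/eqP->|iN] si; [by right|left].
  by exists i.
by move=> [[i iN si]|sN]; [exists i => //; exact: ltnW|exists N].
Qed.

Lemma progression0 sigma r : progression 0 sigma r = set0.
Proof. by apply/seteqP; split => s // -[]. Qed.

Lemma measurable_progression N sigma r : measurable (progression N sigma r).
Proof.
elim: N => [|N IH]; first by rewrite progression0.
by rewrite progressionS; apply: measurableU => //; exact: measurable_interval_set.
Qed.

Lemma lebesgue_progression_ge N sigma r : 0 < r -> 2 * r < sigma ->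
  ((N%:R * (2 * r))%:E <= lebesgue_measure (progression N sigma r))%E.
Proof.
move=> r0 rs; elim: N => [|N IH]; first by rewrite mul0r.
rewrite progressionS measureU.
- rewrite -natr1 mulrDl mul1r EFinD; apply: leeD => //.
  exact/lebesgue_measure_ball_ge/ltW.
- exact: measurable_progression.
- exact: measurable_interval_set.
- apply/seteqP; split=> s // -[[i iN]]; rewrite /interval_set /= !ler_distl.
  have : i%:R + 1 <= N%:R :> R by rewrite natr1 ler_nat.
  by move=> iN' /andP[? ?] /andP[? ?]; nra.
Qed.

Definition hits N (a sigma rho : R) : R :=
  \sum_(i < N) (`|i%:R * sigma - a| <= rho)%R%:R.

Lemma hits_le N a sigma rho : 0 < sigma -> 0 <= rho ->
  hits N a sigma rho <= 1 + 2 * rho / sigma.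
Proof.
move=> s0 r0.
pose lo := (a - rho) / sigma; pose hi := (a + rho) / sigma.
have lohi : lo <= hi + 1.
  apply: (@le_trans _ _ hi); last by rewrite lerDl.
  by rewrite ler_pM2r ?invr_gt0//; lra.
(* [[lo, hi]] is the interval of indices counted by [hits], in units of [sigma]. Truncation at [N]
   lets the induction add exactly one for each index that hits. *)
suff : hits N a sigma rho <= Num.max 0 (Num.min N%:R (hi + 1) - lo).
  move/le_trans; apply; rewrite ge_max; apply/andP; split.
    by rewrite addr_ge0// divr_ge0 ?(ltW s0)// mulr_ge0.
  apply: (@le_trans _ _ (hi + 1 - lo)).
    by rewrite lerD2r ge_min lexx orbT.
  by rewrite /hi /lo le_eqVlt; apply/orP; left; apply/eqP; field; rewrite gt_eqF.
elim: N => [|N IH]; first by rewrite /hits big_ord0 le_max lexx.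
rewrite /hits big_ord_recr /=.
have mono : Num.min N%:R (hi + 1) <= Num.min N.+1%:R (hi + 1).
  by rewrite le_min !ge_min lexx orbT ler_nat leqnSn.
have [HN|HN] := boolP (`|N%:R * sigma - a| <= rho); last first.
  rewrite addr0; apply: (le_trans IH).
  by rewrite ge_max !le_max lexx /= lerD2r mono orbT.
have [N1 N2] : lo <= N%:R /\ N%:R <= hi.
  move: HN; rewrite ler_distl => /andP[H1 H2].
  by rewrite /lo /hi ler_pdivrMr// ler_pdivlMr//.
move: IH; rewrite (_ : Num.min N%:R _ = N%:R); last by apply: min_l; lra.
rewrite (_ : Num.min N.+1%:R _ = N%:R + 1); last first.
  by rewrite -natr1; apply: min_l; lra.
rewrite [Num.max 0 (N%:R - lo)]max_r ?subr_ge0// => IH.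
by rewrite le_max; apply/orP; right; rewrite addrAC lerD2r.
Qed.

Lemma lebesgue_progression_hits N sigma r a rho b : 0 <= b ->
  (forall c, lebesgue_measure (interval_set c r `&` interval_set a rho) <= b%:E)%E ->
  (lebesgue_measure (progression N sigma r `&` interval_set a rho) <=
   (hits N a sigma (rho + r) * b)%:E)%E.
Proof.
move=> b0 Hb; elim: N => [|N IH].
  by rewrite progression0 set0I measure0 /hits big_ord0 mul0r.
rewrite progressionS setIUl /hits big_ord_recr /= mulrDl EFinD.
apply: (@le_trans _ _ (lebesgue_measure (progression N sigma r `&` interval_set a rho)
  + lebesgue_measure (interval_set (N%:R * sigma) r `&` interval_set a rho))%E).
  apply: measureU2; apply: measurableI; try exact: measurable_interval_set.
  exact: measurable_progression.
apply: leeD => //.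
have [HN|HN] := boolP (`|N%:R * sigma - a| <= rho + r); first by rewrite mul1r.
rewrite mul0r (_ : _ `&` _ = set0) ?measure0//.
apply/seteqP; split=> s // -[]; rewrite /interval_set /= => H1 H2.
case/negP: HN; rewrite (_ : _ - a = (s - a) - (s - N%:R * sigma)); last by ring.
exact: le_trans (ler_normB _ _) (lerD H2 H1).
Qed.

(** Up to [rho = c * w], boundedly many intervals are met, each contributes at most [2 * rho], and
    [rho <= w^(1 - beta) * rho^beta]. From there up to 1, a bounded number plus about [rho / sigma]
    intervals of length about [c * w] are met, and the latter give [rho * w^(1 - beta)]. Beyond 1,
    the whole length is about [N * w <= w^(1 - beta)]. *)
Lemma lebesgue_progression_cap N (c w beta a rho : R) :
  0 < c <= 1 -> 0 < w <= 1 -> 0 <= beta <= 1 -> 0 < rho ->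
  N%:R <= w `^ (- beta) ->
  (lebesgue_measure (progression N (c * w `^ beta) (c * w / 4)
      `&` interval_set a rho) <= (10 * w `^ (1 - beta) * rho `^ beta)%:E)%E.
Proof.
move=> /andP[c_0 c1] /andP[w0 w1] /andP[b0 b1] r0 Nw.
have cw0 : 0 < c * w / 4 by rewrite divr_gt0// mulr_gt0.
set u := w `^ (1 - beta) ; set v := rho `^ beta; set sg := w `^ beta.
have u0 : 0 < u by exact: powR_gt0.
have v0 : 0 < v by exact: powR_gt0.
have sg0 : 0 < sg by exact: powR_gt0.
have uw : u * sg = w.
  rewrite -powRD; first by rewrite subrK powRr1// ltW.
  by rewrite (gt_eqF w0) implybT.
have u1 : u <= 1.
  by rewrite -[leRHS](powRr0 w) ger_powR ?w0 ?subr_ge0.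
have wsg : w <= sg by rewrite -uw ler_piMl// ltW.
have NE : N%:R * sg <= 1.
  by rewrite -ler_pdivlMr// div1r -powRN.
have mn : Num.min w rho <= u * v.
  by apply: min_le_interpolation; rewrite ?b0.
have Hh : hits N a (c * sg) (rho + c * w / 4) <= 1 + 2 * (rho + c * w / 4) / (c * sg).
  by apply: hits_le; rewrite ?mulr_gt0// addr_ge0// ltW.
have hits0 : 0 <= hits N a (c * sg) (rho + c * w / 4) by apply: sumr_ge0.
have csg : 0 < c * sg by rewrite mulr_gt0.
have Hc : (rho + c * w / 4) / (c * sg) <= rho / (c * sg) + 1 / 4.
  rewrite mulrDl lerD2l ler_pdivrMr//; nra.
have [rw|wr] := leP rho (c * w).
  apply: le_trans (@lebesgue_progression_hits N (c * sg) (c * w / 4) a rho (2 * rho) _ _) _.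
  - by rewrite mulr_ge0// ltW.
  - move=> z; apply: le_trans (lebesgue_measure_ball_le a (ltW r0)).
    by apply: le_outer_measure => s [].
  - rewrite lee_fin.
    have : rho / (c * sg) <= 1 by rewrite ler_pdivrMr// mul1r; nra.
    have : rho <= u * v by move: mn; rewrite ge_min => /orP[]; nra.
    nra.
have [r1|r1] := leP rho 1.
  apply: le_trans (@lebesgue_progression_hits N (c * sg) (c * w / 4) a rho (2 * (c * w / 4)) _ _) _.
  - by rewrite mulr_ge0// ltW.
  - move=> z; apply: le_trans (lebesgue_measure_ball_le z (ltW cw0)).
    by apply: le_outer_measure => s [].
  - rewrite lee_fin.
    have cwuv : c * w <= u * v.
      move: mn; rewrite ge_min => /orP[]; nra.
    have rv : rho <= v by rewrite -{1}(powRr1 (ltW r0)) ger_powR// r0.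
    have E : rho / (c * sg) * (c * w) = rho * u.
      by rewrite -uw; field; rewrite !gt_eqF.
    have : rho * u <= u * v by nra.
    have : (1 + 2 * (rho + c * w / 4) / (c * sg)) * (2 * (c * w / 4)) <=
        (3 / 2 + 2 * (rho / (c * sg))) * (2 * (c * w / 4)).
      by rewrite ler_pM2r; [lra|lra].
    have : hits N a (c * sg) (rho + c * w / 4) * (2 * (c * w / 4)) <=
       (1 + 2 * (rho + c * w / 4) / (c * sg)) * (2 * (c * w / 4)).
      by rewrite ler_wpM2r//; lra.
    move: (rho / (c * sg)) (hits _ _ _ _) E Hh => B A E _; lra.
have v1 : 1 <= v.
  apply: (@le_trans _ _ (1 `^ beta)); first by rewrite powR1.
  by rewrite ge0_ler_powR ?nnegrE ?(ltW r1) ?(ltW r0).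
apply: le_trans (@lebesgue_progression_hits N (c * sg) (c * w / 4) a rho (2 * (c * w / 4)) _ _) _.
- by rewrite mulr_ge0// ltW.
- move=> z; apply: le_trans (lebesgue_measure_ball_le z (ltW cw0)).
  by apply: le_outer_measure => s [].
- rewrite lee_fin.
  have : hits N a (c * sg) (rho + c * w / 4) <= N%:R.
    rewrite /hits -[in leRHS](card_ord N) -sumr_const; apply: ler_sum => i _.
    by rewrite lern1; case: (_ <= _).
  have : N%:R * w <= u.
    by rewrite -uw mulrCA ler_piMr// ltW.
  have N0 : 0 <= N%:R :> R by exact: ler0n.
  nra.
Qed.

End frostman_products.

(** * Frostman measures on sheared boxes *)

Section pushforward_test.
Context {R : realType} {d n : nat}.
Implicit Types (theta B L : 'I_n -> R) (S : 'I_n -> set R).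

Definition box S : set 'rV[R]_n := [set p | forall i, S i (p ord0 i)].

Lemma measurable_coord_preimage i (A : set R) : measurable A ->
  measurable [set p : 'rV[R]_n | A (p ord0 i)].
Proof. by move=> mA; rewrite -[X in measurable X]setTI; exact: measurable_coord. Qed.

Lemma measurable_box S : (forall i, measurable (S i)) -> measurable (box S).
Proof. by move=> mS; apply: measurable_forall => i; exact: measurable_coord_preimage. Qed.

Lemma prod_powR_sum theta (r : R) : 0 < r ->
  \prod_i r `^ theta i = r `^ (\sum_i theta i).
Proof.
move=> r0; rewrite (big_morph (powR r) (id1 := 1) (op1 := *%R))//.
  by move=> x y; rewrite powRD// (gt_eqF r0) implybT.
exact: powRr0.
Qed.

Lemma measurable_eball1 (z : 'rV[R]_d * R) r : measurable (eball1 z r).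
Proof.
rewrite (_ : eball1 z r = (fun w => enorm1 (w - z)) @^-1` `]-oo, r[); last first.
  by apply/seteqP; split => w; rewrite /eball1 /= in_itv.
rewrite -[X in measurable X]setTI.
suff mf : measurable_fun setT (fun w : 'rV[R]_d * R => enorm1 (w - z)) by exact: mf.
apply: (@measurableT_comp _ _ _ _ _ _ (@Num.sqrt R)).
  exact: continuous_measurable_fun (@sqrt_continuous R).
apply: measurable_funD; apply: measurable_funX.
  apply: (measurableT_comp measurable_enorm).
  apply: measurable_fun_rV => i /=; under eq_fun do rewrite !mxE.
  apply: measurable_funB; last exact: measurable_cst.
  exact: measurableT_comp (measurable_coord i) measurable_fst.
by apply: measurable_funB; [exact: measurable_snd|exact: measurable_cst].
Qed.

(* The shears [G] are absorbed one coordinate at a time by Fubini, so only the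
   sections of the box matter in the bound of the measure of a ball. *)
Lemma frostman_pushforward (alpha : R) theta B L S
    (G : 'I_n -> 'rV[R]_n -> R) (Phi : 'rV[R]_n -> 'rV[R]_d * R) :
  measurable_fun setT Phi -> (forall i, measurable (S i)) ->
  (forall i, measurable_fun setT (G i)) ->
  (forall (i : 'I_n) (p p' : 'rV[R]_n),
    (forall k : 'I_n, (i < k)%N -> p ord0 k = p' ord0 k) -> G i p = G i p') ->
  (forall i, 0 < B i) -> (forall i, 0 <= L i) -> \sum_i theta i = alpha ->
  (forall i (a r : R), 0 < r -> (lebesgue_measure (S i `&` interval_set a r)
     <= (B i * r `^ theta i)%:E)%E) ->
  (forall i, ((L i)%:E <= lebesgue_measure (S i))%E) ->
  (forall z (r : R), 0 < r -> exists zeta : 'I_n -> R, forall p, box S p ->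
     eball1 z r (Phi p) -> forall i, `|p ord0 i + G i p - zeta i| <= r) ->
  exists2 nu : {measure set ('rV[R]_d * R) -> \bar R},
    forall z r, 0 < r -> (nu (eball1 z r) <= (r `^ alpha)%:E)%E &
    forall D, (forall p, box S p -> D (Phi p)) ->
      ((\prod_i (L i / B i))%:E <= nu D)%E.
Proof.
move=> mPhi mS mG depG B0 L0 sum_theta capB lowL ball.
have mP := measurable_box mS.
have PB0 : 0 < \prod_i B i by apply: prodr_gt0.
have kn : 0 <= (\prod_i B i)^-1 by rewrite invr_ge0 ltW.
have [nu nuA] : exists nu : {measure set ('rV[R]_d * R) -> \bar R}, forall A,
    nu A = ((\prod_i B i)^-1%:E * lebesgue_rV n (Phi @^-1` A `&` box S))%E.
  by unshelve eexists (mscale (NngNum kn)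
    (pushforward (mrestr (lebesgue_rV n) mP) Phi)).
exists nu => [z r r0|D PD]; rewrite nuA.
  have [zeta Hz] := ball z r r0.
  (* The shear only moves the centre of the interval, and [capB] is uniform in the centre. *)
  pose S' i (p : 'rV[R]_n) := S i `&` interval_set (zeta i - G i p) r.
  have mS' i : measurable [set p : 'rV[R]_n | S' i p (p ord0 i)].
    apply: measurableI; first exact: measurable_coord_preimage.
    exact: (measurable_set_ler (measurable_norm_sub (measurable_coord i)
      (measurable_funB (measurable_cst (zeta i)) (mG i))) (measurable_cst r)).
  apply: (@le_trans _ _ ((\prod_i B i)^-1%:E *
      lebesgue_rV n [set p : 'rV[R]_n | forall i, S' i p (p ord0 i)]))%E.
    rewrite lee_wpmul2l ?lee_fin//; apply: le_measure; rewrite ?inE.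
    - apply: measurableI => //; rewrite -[X in measurable X]setTI.
      exact: mPhi (measurable_eball1 z r).
    - exact: measurable_forall.
    - move=> p [zp Sp] i; split; first exact: Sp.
      rewrite /interval_set /= (_ : _ - _ = p ord0 i + G i p - zeta i); last by ring.
      exact: Hz.
  have H : (lebesgue_rV n [set p : 'rV[R]_n | forall i, S' i p (p ord0 i)] <=
      (\prod_i (B i * r `^ theta i))%:E)%E.
    apply: lebesgue_rV_triangular_le => //.
    - by move=> i p p' s pp'; rewrite /S' (depG _ _ _ pp').
    - by move=> i; rewrite mulr_ge0 ?powR_ge0// ltW.
    - by move=> i p; exact: capB.
  apply: (le_trans (lee_wpmul2l _ H)); first by rewrite lee_fin.
  rewrite big_split /= prod_powR_sum// sum_theta -EFinM lee_fin mulrA.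
  by rewrite mulVf ?gt_eqF// mul1r.
rewrite (_ : _ `&` _ = box S); last first.
  by apply/seteqP; split => [p []//|p Sp]; split=> //; exact: PD.
rewrite big_split /= prodfV mulrC EFinM lee_wpmul2l ?lee_fin//.
apply: (lebesgue_rV_triangular_ge (S := fun i _ => S i)) => //.
by move=> i; exact: measurable_coord_preimage.
Qed.

Lemma spherical_estimate_pushforward (alpha : R) (p q : \bar R) (C : R)
    theta B L S (G : 'I_n -> 'rV[R]_n -> R) (Phi : 'rV[R]_n -> 'rV[R]_d * R)
    (E : set 'rV[R]_d) (a V : R) :
  (1 <= p)%E -> (1 <= q)%E -> @spherical_estimate R d alpha p q C ->
  measurable_fun setT Phi -> (forall i, measurable (S i)) ->
  (forall i, measurable_fun setT (G i)) ->
  (forall (i : 'I_n) (p p' : 'rV[R]_n),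
    (forall k : 'I_n, (i < k)%N -> p ord0 k = p' ord0 k) -> G i p = G i p') ->
  (forall i, 0 < B i) -> (forall i, 0 < L i) -> \sum_i theta i = alpha ->
  (forall i (a r : R), 0 < r -> (lebesgue_measure (S i `&` interval_set a r)
     <= (B i * r `^ theta i)%:E)%E) ->
  (forall i, ((L i)%:E <= lebesgue_measure (S i))%E) ->
  (forall z (r : R), 0 < r -> exists zeta : 'I_n -> R, forall p, box S p ->
     eball1 z r (Phi p) -> forall i, `|p ord0 i + G i p - zeta i| <= r) ->
  measurable E -> 0 <= V -> (lebesgue_rV d E <= V%:E)%E -> 0 <= a ->
  (forall p, box S p -> domain (Phi p)) ->
  (forall p, box S p -> (a%:E <=
     sphere_measure [set y | E ((Phi p).1 - (Phi p).2 *: y)%R])%E) ->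
  a * (\prod_i (L i / B i)) `^ fine q^-1 <= `|C| * V `^ fine p^-1.
Proof.
move=> p1 q1 HC mPhi mS mG depG B0 L0 sth capB lowL ball mE V0 EV a0 dom avg.
have L0' i : 0 <= L i by exact/ltW.
have [nu nu1 nu2] := frostman_pushforward mPhi mS mG depG B0 L0' sth capB lowL ball.
apply: (spherical_estimate_test p1 q1 HC mE V0 EV nu1 a0).
  by apply: prodr_gt0 => i _; rewrite divr_gt0.
by apply: nu2 => z Sz; split; [exact: dom|exact: avg].
Qed.

End pushforward_test.

(** * Comparison of powers of a small scale *)

Section exponents.
Context {R : realType}.

Lemma exponent_le (A B k1 k2 : R) : 0 < k1 ->
  (forall e : R, 0 < e <= 1 -> k1 * e `^ A <= k2 * e `^ B) -> B <= A.
Proof.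
move=> k10 H; rewrite leNgt; apply/negP => AB.
have BA : 0 < B - A by rewrite subr_gt0.
(* [K] makes [(1 + |k2|) / K] equal to [k1 / 2]; the 1 keeps the numerator positive whatever [k2]
   is. *)
pose K := 2 * (1 + `|k2|) / k1.
have K0 : 0 < K by rewrite divr_gt0// mulr_gt0// ltr_wpDr.
pose e := Num.min 1 (K^-1 `^ (B - A)^-1).
have e0 : 0 < e by rewrite lt_min ltr01 powR_gt0// invr_gt0.
have e1 : e <= 1 by rewrite ge_min lexx.
have eK : e `^ (B - A) <= K^-1.
  apply: (@le_trans _ _ ((K^-1 `^ (B - A)^-1) `^ (B - A))).
    apply: ge0_ler_powR; rewrite ?nnegrE ?(ltW BA) ?(ltW e0) ?powR_ge0//.
    by rewrite ge_min lexx orbT.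
  by rewrite -powRrM mulVf ?gt_eqF// powRr1// invr_ge0 ltW.
have := H e; rewrite e0 e1 => /(_ isT).
rewrite -{1}(subrK A B) powRD; last by rewrite (gt_eqF e0) implybT.
rewrite mulrA ler_pM2r ?powR_gt0// => H1.
have : k1 <= (1 + `|k2|) * K^-1.
  apply: (le_trans H1); apply: (@le_trans _ _ ((1 + `|k2|) * e `^ (B - A))).
    by rewrite ler_wpM2r ?powR_ge0// (le_trans (ler_norm k2))// lerDr.
  by rewrite ler_wpM2l// addr_ge0.
have k20 : 1 + `|k2| != 0 by rewrite gt_eqF// ltr_wpDr.
rewrite /K (_ : _ * _ = k1 / 2); last by field; rewrite gt_eqF// k20.
lra.
Qed.

(** Here [e^a] is the size of the average, [e^b] the mass of [nu] and [e^c] the volume of E; the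
    constants disappear as [e] tends to 0. *)
Lemma test_exponents (a b c rp rq k1 k2 k3 K : R) :
  0 < k1 -> 0 < k2 -> 0 <= k3 ->
  (forall e : R, 0 < e <= 1 ->
    k1 * e `^ a * (k2 * e `^ b) `^ rq <= K * (k3 * e `^ c) `^ rp) ->
  c * rp <= a + b * rq.
Proof.
move=> k10 k20 k30 H.
apply: (@exponent_le _ _ (k1 * k2 `^ rq) (K * k3 `^ rp)).
  by rewrite mulr_gt0 ?powR_gt0.
move=> e /andP[e0 e1]; have := H e; rewrite e0 e1 => /(_ isT).
rewrite !powRM ?powR_ge0 ?(ltW k20)// -!powRrM mulrA.
rewrite powRD; last by rewrite (gt_eqF e0) implybT.
by congr (_ <= _); ring.
Qed.

End exponents.

(** * Centres and radii along the focal graph *)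

Section focal_graph.
Context {R : realType} {d : nat}.
Implicit Types (b x y X : 'rV[R]_d) (i j : 'I_d) (delta eta t : R).

(** Index 0 holds the sheared parameter: its shear depends on all the other coordinates, which the
    triangular bounds allow only for the smallest index. *)
Definition ord_cons (T : Type) (a : T) (f : 'I_d -> T) (i : 'I_d.+1) : T :=
  if unlift ord0 i is Some k then f k else a.

Lemma ord_cons0 T (a : T) f : ord_cons a f ord0 = a.
Proof. by rewrite /ord_cons unlift_none. Qed.

Lemma ord_consS T (a : T) f k : ord_cons a f (lift ord0 k) = f k.
Proof. by rewrite /ord_cons liftK. Qed.

Lemma ord_cons_ind T (P : 'I_d.+1 -> T -> Prop) (a : T) (f : 'I_d -> T) :
  P ord0 a -> (forall k, P (lift ord0 k) (f k)) ->
  forall i : 'I_d.+1, P i (ord_cons a f i).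
Proof.
move=> Pa Pf i; have [k ->|->] := unliftP ord0 i; first by rewrite ord_consS.
by rewrite ord_cons0.
Qed.

Lemma forall_ord_cons (P : 'I_d.+1 -> Prop) :
  P ord0 -> (forall k, P (lift ord0 k)) -> forall i : 'I_d.+1, P i.
Proof. by move=> P0 PS i; have [k ->|->] := unliftP ord0 i. Qed.

Definition tail (p : 'rV[R]_d.+1) : 'rV[R]_d := \row_k p ord0 (lift ord0 k).

Lemma measurable_tail : measurable_fun setT tail.
Proof.
apply: measurable_fun_rV => k; under eq_fun do rewrite mxE.
exact: measurable_coord.
Qed.

Lemma measurable_focal j : measurable_fun setT (@focal R d j).
Proof.
apply: (@measurableT_comp _ _ _ _ _ _ (@Num.sqrt R)).
  exact: continuous_measurable_fun (@sqrt_continuous R).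
apply: measurable_funD; last exact: measurable_sum_sqr.
apply: measurable_funX; apply: measurable_funD; first exact: measurable_cst.
exact: measurable_coord.
Qed.

Lemma enorm_le_small b (c : R) : 0 <= c -> c <= 2 * @c0 R d ->
  (forall k, `|b ord0 k| <= c) -> enorm b < 1.
Proof.
move=> c_0 cc bc.
rewrite -(ltr_sqr (sqrtr_ge0 _)) ?nnegrE// sqr_sqrtr; last first.
  by apply: sumr_ge0 => k _; exact: sqr_ge0.
apply: le_lt_trans (ler_norm _) _.
apply: (@le_lt_trans _ _ (d%:R * c ^+ 2)).
  apply: ler_sum_const; first exact: sqr_ge0.
  by move=> k _; rewrite normrX lerXn2r// nnegrE.
have [d0|d0] := posnP d; first by rewrite d0 mul0r expr1n.
have := @c0_dim R d d0; have := @c0_gt0 R d d0; have := @c0_le R d d0.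
move: (@c0 R d) cc => k cc k1 k0 dk.
have D0 : 0 <= d%:R :> R by exact: ler0n.
apply: (@le_lt_trans _ _ (d%:R * (2 * k) ^+ 2)).
  by rewrite ler_wpM2l// lerXn2r// nnegrE; lra.
rewrite (_ : _ * _ = d%:R * k * (4 * k)); last by ring.
by rewrite dk expr1n; lra.
Qed.

Lemma focal_bounds j b : (forall k, `|b ord0 k| <= 2 * @c0 R d) ->
  7 / 5 <= focal j b <= 8 / 5.
Proof.
move=> bc.
have d0 : (0 < d)%N by case: (j) => m; exact: leq_ltn_trans.
have := @c0_dim R d d0; have := @c0_gt0 R d d0; have := @c0_le R d d0.
move: (@c0 R d) bc => c bc c1 c_0 dc.
set W := \sum_(k : 'I_d | (k < j)%N) b ord0 k ^+ 2.
have W0 : 0 <= W by apply: sumr_ge0 => k _; exact: sqr_ge0.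
have W1 : W <= 1 / 100.
  apply: le_trans (ler_norm _) _.
  apply: (@le_trans _ _ (d%:R * (2 * c) ^+ 2)).
    apply: ler_sum_const; first exact: sqr_ge0.
    move=> k _; rewrite normrX lerXn2r// nnegrE mulr_ge0// ltW//.
  rewrite (_ : _ * _ = d%:R * c * (4 * c)); last by ring.
  by rewrite dc; lra.
have /ler_normlP[b1 b2] := bc j.
rewrite /focal -/W.
have f0 : 0 <= Num.sqrt ((3 / 2 + b ord0 j) ^+ 2 + W) by exact: sqrtr_ge0.
have f2 : Num.sqrt ((3 / 2 + b ord0 j) ^+ 2 + W) ^+ 2 = (3 / 2 + b ord0 j) ^+ 2 + W.
  by rewrite sqr_sqrtr// addr_ge0// sqr_ge0.
move: (b ord0 j) b1 b2 (Num.sqrt _) f0 f2 => s s1 s2 f f0 f2.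
have s3 : s ^+ 2 <= 1 / 100 by nra.
have s4 := sqr_ge0 s.
by apply/andP; split; rewrite -ler_sqr ?nnegrE// ?f2; lra.
Qed.

Lemma sum_pick3 j (a b c : R) :
  \sum_(i < d) (if (i < j)%N then a else if (j < i)%N then b else c) =
  j%:R * a + (d.-1 - j)%:R * b + c.
Proof.
have jd := ltn_ord j.
rewrite -(big_mkord xpredT (fun i : nat => if (i < j)%N then a else if (j < i)%N then b else c)).
rewrite (@big_cat_nat _ _ _ j)//=; last exact: ltnW.
rewrite -addrA; congr (_ + _).
  rewrite (eq_big_nat _ _ (F2 := fun=> a)); last by move=> i /andP[_ ->].
  by rewrite sumr_const_nat subn0 mulr_natl.
rewrite big_ltn// !ltnn addrC; congr (_ + _).
rewrite (eq_big_nat _ _ (F2 := fun=> b)).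
  by rewrite sumr_const_nat mulr_natl; congr (_ *+ _); lia.
by move=> i /andP[ji _]; rewrite ji ltnNge (ltnW ji).
Qed.

Definition plate_bound j delta eta : R :=
  (2 * (600 * delta)) ^+ j * (2 * eta) ^+ (d.-1 - j) * (2 * (600 * delta)).

Lemma enorm1_sqr (w : 'rV[R]_d * R) :
  enorm1 w ^+ 2 = enorm w.1 ^+ 2 + w.2 ^+ 2.
Proof. by rewrite [LHS]sqr_sqrtr// addr_ge0// sqr_ge0. Qed.

Lemma coord_le_enorm1 (w : 'rV[R]_d * R) k : `|w.1 ord0 k| <= enorm1 w.
Proof.
apply: (le_trans (coord_le_enorm _ _)).
by rewrite -ler_sqr ?nnegrE ?sqrtr_ge0// enorm1_sqr lerDl sqr_ge0.
Qed.

Lemma snd_le_enorm1 (w : 'rV[R]_d * R) : `|w.2| <= enorm1 w.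
Proof.
rewrite -ler_sqr ?nnegrE ?sqrtr_ge0// enorm1_sqr.
by rewrite real_normK ?num_real// lerDr sqr_ge0.
Qed.

(** Length over Frostman factor: the share that an interval of half-length [h] and exponent [theta]
    has in the mass of the normalised measure. *)
Lemma interval_ratio (h theta : R) : 0 < h ->
  2 * h / (2 * h `^ (1 - theta)) = h `^ theta.
Proof.
move=> h0; rewrite invfM mulrACA mulfV// mul1r -powRN opprB.
rewrite -{1}(powRr1 (ltW h0)) -powRD; last by rewrite (gt_eqF h0) implybT.
by congr (_ `^ _); ring.
Qed.

(* The sets [S] are the ranges of the coordinates of the centres; the radius is
   sheared along the graph of [focal]. *)
Lemma focal_graph_test (alpha : R) (p q : \bar R) (C : R) j delta eta
    (theta_t : R) (theta B L : 'I_d -> R) (S : 'I_d -> set R)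
    (E : set 'rV[R]_d) (V : R) :
  (1 <= p)%E -> (1 <= q)%E -> @spherical_estimate R d alpha p q C ->
  0 < eta <= 1 -> 0 < delta -> delta <= @c0 R d * eta ^+ 2 ->
  0 <= theta_t <= 1 -> theta_t + \sum_k theta k = alpha ->
  (forall k, measurable (S k)) -> (forall k, 0 < B k) -> (forall k, 0 < L k) ->
  (forall k (a r : R), 0 < r -> (lebesgue_measure (S k `&` interval_set a r)
     <= (B k * r `^ theta k)%:E)%E) ->
  (forall k, ((L k)%:E <= lebesgue_measure (S k))%E) ->
  measurable E -> 0 <= V -> (lebesgue_rV d E <= V%:E)%E ->
  (forall b, (forall k, S k (b ord0 k)) ->
    (forall k, `|b ord0 k| <= 2 * @c0 R d) /\
    exists y0, [/\ forall y, plate j delta eta y -> E (y0 + y),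
      near_focal j delta eta (b - y0) (focal j (b - y0)) &
      focal j b = focal j (b - y0)]) ->
  @avg_const R d * (delta ^+ j * eta ^+ (d.-1 - j)) *
    (delta `^ theta_t * \prod_k (L k / B k)) `^ fine q^-1 <=
  `|C| * V `^ fine p^-1.
Proof.
move=> p1 q1 HC e01 de0 dee tht sth mS B0 L0 capB lowL mE V0 EV HS.
have d0 : (0 < d)%N by case: (j) => m; exact: leq_ltn_trans.
have c_0 := @c0_gt0 R d d0; have c1 := @c0_le R d d0.
have [e0 e1] := andP e01.
have dec : delta <= @c0 R d.
  by apply: (le_trans dee); rewrite ler_piMr ?(ltW c_0)// expr_le1// ltW.
pose S' := ord_cons (interval_set 0 delta) S.
pose G := ord_cons (fun p : 'rV[R]_d.+1 => focal j (tail p)) (fun _ _ => 0).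
pose Phi (p : 'rV[R]_d.+1) := (tail p, p ord0 ord0 + focal j (tail p)).
pose theta' := ord_cons theta_t theta.
pose B' := ord_cons (2 * delta `^ (1 - theta_t)) B.
pose L' := ord_cons (2 * delta) L.
have mft : measurable_fun setT (fun p : 'rV[R]_d.+1 => focal j (tail p)).
  exact: measurableT_comp (measurable_focal j) measurable_tail.
have boxP u : box S' u -> `|u ord0 ord0| <= delta /\ forall k, S k (tail u ord0 k).
  move=> Su; split; first by have := Su ord0; rewrite /S' ord_cons0 /interval_set /= subr0.
  by move=> k; have := Su (lift ord0 k); rewrite /S' ord_consS mxE.
have -> : delta `^ theta_t * \prod_k (L k / B k) = \prod_i (L' i / B' i).
  rewrite big_ord_recl /L' /B' !ord_cons0 interval_ratio//; congr (_ * _).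
  by apply: eq_bigr => k _; rewrite !ord_consS.
apply: (@spherical_estimate_pushforward R d d.+1 alpha p q C theta' B' L' S' G
  Phi E _ V) => //.
- apply: measurable_fun_pair; first exact: measurable_tail.
  by apply: measurable_funD => //; exact: measurable_coord.
- by apply: (ord_cons_ind (P := fun _ => measurable)) => //; exact: measurable_interval_set.
- by apply: (ord_cons_ind (P := fun _ => measurable_fun setT)).
- apply: forall_ord_cons => [b b' bb'|k b b' _]; last by rewrite /G !ord_consS.
  rewrite /G !ord_cons0; congr (focal j _); apply/rowP => k; rewrite !mxE.
  exact: bb'.
- apply: (ord_cons_ind (P := fun _ r => 0 < r)) => //.
  by rewrite mulr_gt0// powR_gt0.
- by apply: (ord_cons_ind (P := fun _ r => 0 < r)) => //; rewrite mulr_gt0.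
- rewrite big_ord_recl /theta' ord_cons0 -sth; congr (_ + _).
  by apply: eq_bigr => k _; rewrite ord_consS.
- apply: forall_ord_cons => [a r r0|k a r r0].
    by rewrite /S' /B' /theta' !ord_cons0; exact: lebesgue_interval_cap.
  by rewrite /S' /B' /theta' !ord_consS; exact: capB.
- apply: forall_ord_cons => [|k]; last by rewrite /S' /L' !ord_consS.
  by rewrite /S' /L' !ord_cons0; exact/lebesgue_measure_ball_ge/ltW.
- move=> z r r0; exists (ord_cons z.2 (fun k => z.1 ord0 k)) => b Sb zb.
  apply: forall_ord_cons => [|k].
    rewrite /G !ord_cons0; apply: le_trans (ltW zb).
    exact: (snd_le_enorm1 (Phi b - z)).
  rewrite /G !ord_consS addr0; apply: le_trans (ltW zb).
  apply: le_trans (coord_le_enorm1 (Phi b - z) k).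
  by rewrite !mxE.
- rewrite mulr_ge0 ?(ltW (@avg_const_gt0 R d d0))// mulr_ge0 ?exprn_ge0// ltW//.
- move=> b /boxP[b0 /HS[bc _]]; split => /=.
    rewrite /eball /= subr0; apply: enorm_le_small bc => //.
    by rewrite mulr_ge0// ltW.
  rewrite in_itv/=; have /andP[f1 f2] := focal_bounds j bc.
  by move: b0; rewrite ler_norml => /andP[? ?]; apply/andP; split; lra.
- move=> b /boxP[b0 /HS[_ [y0 [plE [n1 n2 n3 n4] fE]]]].
  apply: (sphere_measure_plate e01 de0 dee mE plE); split => //=.
  by rewrite -fE addrK.
Qed.

(** The centres fill the box of tolerances of [near_focal]: half-sides [c0] below [j], [delta / eta]
    above and [delta / eta^2] at [j]. The exponents stay free, to be distributed according to the
    condition sought. *)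
Lemma standard_test (alpha : R) (p q : \bar R) (C : R) j delta eta
    (theta_t theta_w theta_v theta_j : R) :
  (1 <= p)%E -> (1 <= q)%E -> @spherical_estimate R d alpha p q C ->
  0 < eta <= 1 -> 0 < delta -> delta <= @c0 R d * eta ^+ 2 ->
  0 <= theta_t <= 1 -> 0 <= theta_w <= 1 -> 0 <= theta_v <= 1 ->
  0 <= theta_j <= 1 ->
  theta_t + (j%:R * theta_w + (d.-1 - j)%:R * theta_v + theta_j) = alpha ->
  @avg_const R d * (delta ^+ j * eta ^+ (d.-1 - j)) *
    (delta `^ theta_t * ((@c0 R d `^ theta_w) ^+ j *
       ((delta / eta) `^ theta_v) ^+ (d.-1 - j) *
       (delta / eta ^+ 2) `^ theta_j)) `^ fine q^-1 <=
  `|C| * plate_bound j delta eta `^ fine p^-1.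
Proof.
move=> p1 q1 HC e01 de0 dee tht thw thv thj sth.
have d0 : (0 < d)%N by case: (j) => m; exact: leq_ltn_trans.
have c_0 := @c0_gt0 R d d0.
have [e0 e1] := andP e01.
have e2 : 0 < eta ^+ 2 by rewrite exprn_gt0.
pose pick3 (x y z : R) (k : 'I_d) : R :=
  if (k < j)%N then x else if (j < k)%N then y else z.
pose h := pick3 (@c0 R d) (delta / eta) (delta / eta ^+ 2).
pose theta := pick3 theta_w theta_v theta_j.
have h0 k : 0 < h k.
  by rewrite /h /pick3; case: ifP => // _; case: ifP => _; rewrite divr_gt0.
have th k : 0 <= theta k <= 1.
  by rewrite /theta /pick3; case: ifP => // _; case: ifP.
have u1 : delta / eta ^+ 2 <= @c0 R d by rewrite ler_pdivrMr.
have v1 : delta / eta <= @c0 R d.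
  rewrite ler_pdivrMr//; apply: (le_trans dee).
  by rewrite ler_wpM2l ?(ltW c_0)// expr2 ler_piMl// ltW.
have hc k : h k <= @c0 R d.
  by rewrite /h /pick3; case: ifP => // _; case: ifP.
have -> : (@c0 R d `^ theta_w) ^+ j * ((delta / eta) `^ theta_v) ^+ (d.-1 - j) *
    (delta / eta ^+ 2) `^ theta_j =
    \prod_k (2 * h k / (2 * h k `^ (1 - theta k))).
  rewrite -prod_split3; apply: eq_bigr => k _.
  by rewrite interval_ratio// /h /theta /pick3; case: ifP => // _; case: ifP.
apply: (focal_graph_test (S := fun k => interval_set 0 (h k)) (theta := theta)
  (E := translated_plate 0 j delta eta) p1 q1 HC e01 de0 dee tht).
- by rewrite -sth; congr (_ + _); exact: sum_pick3.
- by move=> k; exact: measurable_interval_set.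
- by move=> k; rewrite mulr_gt0// powR_gt0.
- by move=> k; rewrite mulr_gt0.
- by move=> k a r r0; exact: lebesgue_interval_cap.
- by move=> k; exact/lebesgue_measure_ball_ge/ltW.
- exact: measurable_translated_plate.
- by rewrite /plate_bound; apply: mulr_ge0; [apply: mulr_ge0; apply: exprn_ge0|]; lra.
- exact: lebesgue_translated_plate_le (ltW de0) (ltW e0).
- move=> b Sb.
  have bh k : `|b ord0 k| <= h k by have := Sb k; rewrite /interval_set /= subr0.
  split; first by move=> k; apply: (le_trans (bh k)); apply: (le_trans (hc k)); lra.
  exists 0; rewrite subr0; split => //; first by move=> y; exact: translated_plateP.
  split.
  + by move=> i ij; have := bh i; rewrite /h /pick3 ij.
  + by move=> i ji; have := bh i; rewrite /h /pick3 ji ltnNge (ltnW ji).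
  + by have := bh j; rewrite /h /pick3 !ltnn.
  + by rewrite subrr normr0 ltW.
Qed.

End focal_graph.

(** * Exponents of single plates *)

Section standard_exponents.
Context {R : realType} {d : nat}.
Implicit Types (j : 'I_d).

Lemma powR_exprn (x s : R) n : (x `^ s) ^+ n = x `^ (n%:R * s).
Proof. by rewrite -powR_mulrn ?powR_ge0// -powRrM mulrC. Qed.

Lemma powR_add (e s u : R) : 0 < e -> e `^ (s + u) = e `^ s * e `^ u.
Proof. by move=> e0; rewrite powRD// (gt_eqF e0) implybT. Qed.

(* Caps of width [eta = 1]. *)
Lemma exponents_wide (alpha : R) (p q : \bar R) (C : R) j (theta_w theta : R) :
  (1 <= p)%E -> (1 <= q)%E -> @spherical_estimate R d alpha p q C ->
  0 <= theta_w <= 1 -> 0 <= theta <= 1 ->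
  j%:R * theta_w + (d.+1 - j)%:R * theta = alpha ->
  j.+1%:R * fine p^-1 <= j%:R + (d.+1 - j)%:R * theta * fine q^-1.
Proof.
move=> p1 q1 HC thw th sth.
have d0 : (0 < d)%N by case: (j) => m; exact: leq_ltn_trans.
have jd := ltn_ord j.
have c_0 := @c0_gt0 R d d0.
set m := (d.-1 - j)%N.
(* With [eta = 1], the sides that shrink with [delta] are the radius, coordinate [j] and the
   [d - 1 - j] coordinates after it. *)
have mE : (d.+1 - j)%:R = m%:R + 2 :> R.
  by rewrite -natrD; congr (_%:R); rewrite /m; lia.
have sth' : theta + (j%:R * theta_w + m%:R * theta + theta) = alpha.
  by rewrite -sth mE; ring.
set c := @c0 R d in c_0.
have [w w0 wE] : exists2 w : R, 0 < w & w = 600 by exists 600; lra.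
pose k2 := c `^ theta * ((c `^ theta_w) ^+ j * (c `^ theta) ^+ m * c `^ theta).
pose k3 : R := (2 * (w * c)) ^+ j * 2 ^+ m * (2 * (w * c)).
have k60 : 0 < 2 * (w * c) by rewrite !mulr_gt0.
apply: (@test_exponents R _ _ _ _ _ (@avg_const R d * c ^+ j) k2 k3 `|C|).
- by rewrite mulr_gt0 ?exprn_gt0// avg_const_gt0.
- by rewrite /k2 !mulr_gt0 ?exprn_gt0 ?powR_gt0.
- by have k6 := ltW k60; apply: mulr_ge0 => //; rewrite mulr_ge0 ?exprn_ge0.
- move=> e /andP[e0 e1].
  have ce : 0 < c * e by rewrite mulr_gt0.
  have e01 : 0 < (1 : R) <= 1 by rewrite ltr01 lexx.
  have dee : c * e <= c * 1 ^+ 2 by rewrite expr1n ler_pM2l.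
  have := standard_test p1 q1 HC e01 ce dee th thw th th sth'.
  rewrite /plate_bound -wE !expr1n !divr1 !mulr1 -/c -/m.
  congr (_ * _ `^ _ <= _ * _ `^ _).
  + by rewrite exprMn mulrA -[e ^+ j]powR_mulrn// ltW.
  + rewrite mE !(powRM _ (ltW c_0) (ltW e0)) !exprMn /k2 !powR_exprn.
    rewrite (_ : (m%:R + 2) * theta = theta + m%:R * theta + theta); last by ring.
    by rewrite !powR_add//; ring.
  + rewrite powR_mulrn ?(ltW e0)// /k3 exprS.
    rewrite (_ : 2 * (w * (c * e)) = 2 * (w * c) * e); last by ring.
    by rewrite exprMn; ring.
Qed.

(* Caps of width [eta ~ sqrt delta], of Knapp type. *)
Lemma exponents_narrow (alpha : R) (p q : \bar R) (C : R) j
    (theta_t theta_u theta_v : R) :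
  (1 <= p)%E -> (1 <= q)%E -> @spherical_estimate R d alpha p q C ->
  0 <= theta_t <= 1 -> 0 <= theta_u <= 1 -> 0 <= theta_v <= 1 ->
  theta_t + j.+1%:R * theta_u + (d.-1 - j)%:R * theta_v = alpha ->
  (d + j.+1)%:R * fine p^-1 <=
    (d + j)%:R - 1 + (2 * theta_t + (d.-1 - j)%:R * theta_v) * fine q^-1.
Proof.
move=> p1 q1 HC tht thu thv sth.
have d0 : (0 < d)%N by case: (j) => m; exact: leq_ltn_trans.
have jd := ltn_ord j.
have c_0 := @c0_gt0 R d d0.
set m := (d.-1 - j)%N in sth *.
have mE : (d + j.+1)%:R = (2 * j + m + 2)%:R :> R.
  by congr (_%:R); rewrite /m; lia.
have mE' : (d + j)%:R - 1 = (2 * j + m)%:R :> R.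
  by rewrite (_ : (d + j)%N = (2 * j + m).+1) -?natr1 ?addrK// /m; lia.
(* For [delta = c * eta^2] the side [delta / eta^2] is constant, so coordinate [j] joins the first
   [j] ones: there are [j + 1] long sides, of exponent [theta_u]. *)
have sth' : theta_t + (j%:R * theta_u + m%:R * theta_v + theta_u) = alpha.
  by rewrite -sth -natr1; ring.
rewrite mE mE'.
set c := @c0 R d in c_0.
have [w w0 wE] : exists2 w : R, 0 < w & w = 600 by exists 600; lra.
pose k2 := c `^ theta_t * ((c `^ theta_u) ^+ j * (c `^ theta_v) ^+ m * c `^ theta_u).
pose k3 : R := (2 * (w * c)) ^+ j * 2 ^+ m * (2 * (w * c)).
have k60 : 0 < 2 * (w * c) by rewrite !mulr_gt0.
apply: (@test_exponents R _ _ _ _ _ (@avg_const R d * c ^+ j) k2 k3 `|C|).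
- by rewrite mulr_gt0 ?exprn_gt0// avg_const_gt0.
- by rewrite /k2 !mulr_gt0 ?exprn_gt0 ?powR_gt0.
- by have k6 := ltW k60; apply: mulr_ge0 => //; rewrite mulr_ge0 ?exprn_ge0.
- move=> e /andP[e0 e1].
  have e2 : 0 < e ^+ 2 by rewrite exprn_gt0.
  have ce : 0 < c * e ^+ 2 by rewrite mulr_gt0.
  have e01 : 0 < e <= 1 by rewrite e0 e1.
  have := standard_test p1 q1 HC e01 ce (lexx _) tht thu thv thu sth'.
  rewrite /plate_bound -wE -/c -/m.
  rewrite (_ : c * e ^+ 2 / e = c * e); last by field; rewrite gt_eqF.
  rewrite [c * e ^+ 2 / e ^+ 2]mulfK; last by rewrite gt_eqF.
  congr (_ * _ `^ _ <= _ * _ `^ _).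
  + rewrite powR_mulrn ?(ltW e0)// exprD exprM exprMn; ring.
  + rewrite !(powRM _ (ltW c_0)) ?(ltW e0) ?(ltW e2)// !exprMn /k2 !powR_exprn.
    by rewrite powR_add// [e `^ (2 * _)]powRrM powR_mulrn ?(ltW e0)//; ring.
  + rewrite powR_mulrn ?(ltW e0)// /k3.
    rewrite (exprD e (2 * j + m) 2) (exprD e (2 * j) m) (exprM e 2 j).
    rewrite (_ : 2 * (w * (c * e ^+ 2)) = 2 * (w * c) * e ^+ 2); last by ring.
    by rewrite !exprMn; ring.
Qed.

End standard_exponents.

(** * Unions of plates in the plane *)

Section plate_unions.
Context {R : realType}.

Definition plate_union d (N : nat) (y0 : nat -> 'rV[R]_d) (j : 'I_d)
    (delta eta : R) : set 'rV[R]_d :=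
  [set y | exists2 i, (i < N)%N & translated_plate (y0 i) j delta eta y].

Lemma plate_unionS d N (y0 : nat -> 'rV[R]_d) j delta eta :
  plate_union N.+1 y0 j delta eta =
  plate_union N y0 j delta eta `|` translated_plate (y0 N) j delta eta.
Proof.
apply/seteqP; split=> y.
  move=> [i]; rewrite ltnS leq_eqVlt => /orP[/eqP->|iN] yi; [by right|left].
  by exists i.
by move=> [[i iN yi]|yN]; [exists i => //; exact: ltnW|exists N].
Qed.

Lemma plate_union0 d (y0 : nat -> 'rV[R]_d) j delta eta :
  plate_union 0 y0 j delta eta = set0.
Proof. by apply/seteqP; split => y // -[]. Qed.

Lemma measurable_plate_union d N (y0 : nat -> 'rV[R]_d) j delta eta :
  measurable (plate_union N y0 j delta eta).
Proof.
elim: N => [|N IH]; first by rewrite plate_union0.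
by rewrite plate_unionS; apply: measurableU => //; exact: measurable_translated_plate.
Qed.

Lemma lebesgue_plate_union_le d N (y0 : nat -> 'rV[R]_d) j delta eta :
  0 <= delta -> 0 <= eta ->
  (lebesgue_rV d (plate_union N y0 j delta eta) <=
   (N%:R * plate_bound j delta eta)%:E)%E.
Proof.
move=> de0 e0; elim: N => [|N IH]; first by rewrite plate_union0 measure0 mul0r.
rewrite plate_unionS -natr1 mulrDl mul1r EFinD.
apply: (@le_trans _ _ (lebesgue_rV d (plate_union N y0 j delta eta) +
  lebesgue_rV d (translated_plate (y0 N) j delta eta))%E).
  by apply: measureU2; [exact: measurable_plate_union|exact: measurable_translated_plate].
by apply: leeD => //; exact: lebesgue_translated_plate_le.
Qed.

Lemma progression_length (w beta : R) : 0 < w <= 1 -> 0 <= beta ->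
  exists2 N : nat, N%:R <= w `^ (- beta) & w `^ (- beta) <= 2 * N%:R.
Proof.
move=> /andP[w0 w1] b0.
have x1 : 1 <= w `^ (- beta).
  by rewrite -(powRr0 w) ger_powR ?w0// oppr_le0.
exists (Num.truncn (w `^ (- beta))).
  by have /andP[] := truncn_itv (le_trans ler01 x1).
have /andP[_ xN] := truncn_itv (le_trans ler01 x1).
have : (1 <= Num.truncn (w `^ (- beta)))%N.
  by rewrite truncn_ge_nat ?(le_trans ler01 x1).
rewrite -(ler_nat R); move: xN; rewrite -natr1; lra.
Qed.

Lemma progression_index_le N i (c w beta : R) : (i < N)%N -> 0 < c ->
  N%:R <= w `^ (- beta) -> 0 < w ->
  0 <= i%:R * (c * w `^ beta) <= c.
Proof.
move=> iN c_0 Nw w0.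
have wb : 0 < w `^ beta by exact: powR_gt0.
rewrite mulr_ge0 ?(ltW (mulr_gt0 c_0 wb))//=.
rewrite mulrCA ler_piMr ?(ltW c_0)// -ler_pdivlMr// div1r -powRN.
by apply: le_trans Nw; rewrite ler_nat ltnW.
Qed.

Lemma progression_lower N (c w beta : R) : 0 < c -> 0 < w <= 1 ->
  0 <= beta <= 1 -> w `^ (- beta) <= 2 * N%:R ->
  ((c / 4 * w `^ (1 - beta))%:E <=
    lebesgue_measure (progression N (c * w `^ beta) (c * w / 4)))%E.
Proof.
move=> c_0 /andP[w0 w1] /andP[b0 b1] Nw.
have cw : 0 < c * w by rewrite mulr_gt0.
apply: le_trans (lebesgue_progression_ge N _ _); last 2 first.
- by rewrite divr_gt0.
- have : c * w <= c * w `^ beta.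
    by rewrite ler_pM2l// -{1}(powRr1 (ltW w0)) ger_powR// w0.
  by lra.
rewrite lee_fin powR_add// powRr1 ?(ltW w0)//.
have : c * w * w `^ (- beta) <= c * w * (2 * N%:R) by rewrite ler_pM2l.
lra.
Qed.

End plate_unions.

Section circles_narrow.
Context {R : realType}.
Definition on_second (s : R) : 'rV[R]_2 := \row_k (if k == ord0 then 0 else s).

Lemma ord2P (P : 'I_2 -> Prop) : P ord0 -> P (lift ord0 ord0) -> forall k, P k.
Proof.
move=> P0 P1 k; have [l ->|->] := unliftP ord0 k => //.
by rewrite (ord1 l).
Qed.

(* Parallel Knapp plates, translated along their long side. *)
Lemma exponents_circles_le2 (alpha : R) (p q : \bar R) (C : R) :
  (1 <= p)%E -> (1 <= q)%E -> @spherical_estimate R 2 alpha p q C ->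
  1 < alpha <= 2 -> (4 - alpha) * fine p^-1 <= 1.
Proof.
move=> p1 q1 HC /andP[a1 a2].
(* The radius takes exponent 0 and the first coordinate exponent 1, so the progression carries
   [alpha - 1]. *)
pose beta := alpha - 1.
have b01 : 0 <= beta <= 1 by rewrite /beta; apply/andP; split; lra.
have [b0 b1] := andP b01.
pose c := @c0 R 2.
have c_0 : 0 < c by exact: c0_gt0.
have c_1 : c <= 1 / (100 * 100) by exact: c0_le.
have [w w0 wE] : exists2 w : R, 0 < w & w = 600 by exists 600; lra.
(* About [e^(-beta)] plates of area [e^3] are used, each giving an average of about [e]; the
   coefficient 0 records a mass of [nu] bounded below. *)
suff : (3 - beta) * fine p^-1 <= 1 + 0 * fine q^-1.
  by rewrite mul0r addr0 /beta; congr (_ * _ <= _); ring.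
apply: (@test_exponents R _ _ _ _ _ (@avg_const R 2) (c * (c / 40))
  (2 * (2 * (w * c))) `|C|).
- exact: avg_const_gt0.
- by rewrite !mulr_gt0// divr_gt0.
- by rewrite !mulr_ge0// ltW.
move=> e /andP[e0 e1].
have e01 : 0 < e <= 1 by rewrite e0.
have e2 : 0 < e ^+ 2 by rewrite exprn_gt0.
have de0 : 0 < c * e ^+ 2 by rewrite mulr_gt0.
have [N N1 N2] := progression_length e01 b0.
have u0 : 0 < e `^ (1 - beta) by exact: powR_gt0.
pose sg := c * e `^ beta.
pose S := fun k : 'I_2 => if k == ord0 then interval_set 0 c
                          else progression N sg (c * e / 4).
pose theta := fun k : 'I_2 => if k == ord0 then 1 else beta.
pose B := fun k : 'I_2 => if k == ord0 then 2 * c `^ (1 - 1)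
                          else 10 * e `^ (1 - beta).
pose L := fun k : 'I_2 => if k == ord0 then 2 * c else c / 4 * e `^ (1 - beta).
(* For [j = 0], [focal] sees only the first coordinate, so translations along the second leave it
   unchanged, as [focal_graph_test] requires. *)
pose y0 (i : nat) : 'rV[R]_2 := on_second (i%:R * sg).
have pb0 : 0 <= plate_bound (d := 2) ord0 (c * e ^+ 2) e.
  rewrite /plate_bound -wE; apply: mulr_ge0; first apply: mulr_ge0;
    by rewrite ?exprn_ge0// !mulr_ge0// ltW.
have := @focal_graph_test R 2 alpha p q C ord0 (c * e ^+ 2) e 0 theta B L S
  (plate_union N y0 ord0 (c * e ^+ 2) e)
  (e `^ (- beta) * plate_bound (d := 2) ord0 (c * e ^+ 2) e)
  p1 q1 HC e01 de0 (lexx _).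
have E1 : \prod_k (L k / B k) = c * (c / 40).
  rewrite !big_ord_recl big_ord0 /L /B /= subrr powRr0.
  by field; rewrite gt_eqF.
have E2 : plate_bound (d := 2) ord0 (c * e ^+ 2) e =
    2 * (2 * (w * c)) * e `^ 3.
  by rewrite /plate_bound -wE powR_mulrn ?(ltW e0)//=; ring.
rewrite E1 powRr0 mul1r expr0 mul1r expr1 E2.
have -> : e `^ (- beta) * (2 * (2 * (w * c)) * e `^ 3) =
    2 * (2 * (w * c)) * e `^ (3 - beta).
  by rewrite (powR_add 3 (- beta) e0); ring.
rewrite powRr0 mulr1 powRr1 ?(ltW e0)//; apply.
- by rewrite lexx ler01.
- by rewrite !big_ord_recl big_ord0 /theta /= /beta; ring.
- apply: ord2P; [exact: measurable_interval_set|exact: measurable_progression].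
- by apply: ord2P; rewrite /B /= mulr_gt0// powR_gt0.
- by apply: ord2P; rewrite /L /= mulr_gt0// divr_gt0.
- apply: ord2P => a r r0.
    by apply: lebesgue_interval_cap => //; rewrite ler01 lexx.
  apply: lebesgue_progression_cap => //; apply/andP; split=> //; lra.
- apply: ord2P; first exact/lebesgue_measure_ball_ge/ltW.
  exact: progression_lower.
- exact: measurable_plate_union.
- by rewrite mulr_ge0 ?powR_ge0// -?E2; rewrite !mulr_ge0 ?(ltW w0) ?(ltW c_0).
- apply: le_trans (lebesgue_plate_union_le _ _ _ (ltW de0) (ltW e0)) _.
  rewrite lee_fin E2 (powR_add 3 (- beta) e0).
  have : N%:R * e `^ 3 <= e `^ (- beta) * e `^ 3 by rewrite ler_pM2r ?powR_gt0.
  have : 0 <= 2 * (2 * (w * c)) by rewrite !mulr_ge0 ?(ltW w0) ?(ltW c_0).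
  move: (2 * (2 * _)) => k k0; nra.
- move=> b Sb.
  have bl : `|b ord0 ord0| <= c.
    by have := Sb ord0; rewrite /S /interval_set /= subr0.
  have [i iN bi] : exists2 i, (i < N)%N &
    `|b ord0 (lift ord0 ord0) - i%:R * sg| <= c * e / 4 := Sb (lift ord0 ord0).
  have := progression_index_le iN c_0 N1 e0; rewrite -/sg => /andP[i0 i1].
  have ce : c * e <= c by rewrite ler_piMr// ltW.
  split.
    rewrite -/c; apply: ord2P; first by apply: (le_trans bl); lra.
    move: bi; rewrite !ler_norml => /andP[? ?]; apply/andP; split; lra.
  exists (y0 i); split.
  + by move=> y Py; exists i => //; exact: translated_plateP.
  + split => [k|||]; rewrite ?ltn0//.
    * apply: ord2P; rewrite ?ltnn// => _; rewrite !mxE /=.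
      rewrite (_ : c * e ^+ 2 / e = c * e); last by field; rewrite gt_eqF.
      by have ce0 := mulr_gt0 c_0 e0; apply: (le_trans bi); lra.
    * rewrite !mxE /= subr0 mulfK ?gt_eqF//.
    * by rewrite subrr normr0 ltW.
  + rewrite /focal !mxE /= subr0; congr (Num.sqrt (_ + _)).
    by rewrite !big_pred0.
Qed.

End circles_narrow.

Section circles_wide.
Context {R : realType}.

(** The relation defining [focal] is solved for the coordinate of the centre on axis [j], with the
    radius [t] and the transverse coordinate [b] as parameters. An error [delta / 4] in that
    coordinate costs at most [delta] in the radius. *)
Lemma inverse_focal (c b tau e delta : R) :
  0 < c -> c <= 1 / (100 * 100) -> `|b| <= c / 4 -> `|tau| <= c / 4 ->
  0 < delta -> delta <= c -> `|e| <= delta / 4 ->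
  let t := 3 / 2 + tau in
  let X := e + (Num.sqrt (t ^+ 2 - b ^+ 2) - 3 / 2) in
  `|X| <= c /\ `|t - Num.sqrt ((3 / 2 + X) ^+ 2 + b ^+ 2)| <= delta.
Proof.
move=> c_0 c1 b1 tau1 de0 de1 e1 t.
have t1 : 7 / 5 <= t by move: tau1; rewrite /t ler_norml => /andP[? ?]; lra.
have t2 : t <= 8 / 5 by move: tau1; rewrite /t ler_norml => /andP[? ?]; lra.
have bb : b ^+ 2 <= c / 16.
  by rewrite -real_normK ?num_real//; have := normr_ge0 b; nra.
have bb0 := sqr_ge0 b.
have s0 : 0 <= Num.sqrt (t ^+ 2 - b ^+ 2) by exact: sqrtr_ge0.
have s2 : Num.sqrt (t ^+ 2 - b ^+ 2) ^+ 2 = t ^+ 2 - b ^+ 2.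
  by rewrite sqr_sqrtr// subr_ge0; nra.
move: (Num.sqrt (t ^+ 2 - b ^+ 2)) s0 s2 => s s0 s2 X.
have ts : s <= t by nra.
have ts' : t - c / 16 <= s by nra.
have X3 : 3 / 2 + X = s + e by rewrite /X; ring.
split.
  move: tau1 e1; rewrite /X /t in ts ts' *.
  by rewrite !ler_norml => /andP[? ?] /andP[? ?]; apply/andP; split; lra.
rewrite X3.
have u0 : 0 <= Num.sqrt ((s + e) ^+ 2 + b ^+ 2) by exact: sqrtr_ge0.
have u2 : Num.sqrt ((s + e) ^+ 2 + b ^+ 2) ^+ 2 = (s + e) ^+ 2 + b ^+ 2.
  by rewrite sqr_sqrtr// addr_ge0// sqr_ge0.
move: (Num.sqrt _) u0 u2 => u u0 u2.
have E : (t - u) * (t + u) = - (e * (2 * s + e)).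
  by rewrite -subr_sqr u2; lra.
have : `|t - u| * (t + u) <= delta / 4 * 4.
  rewrite -[X in _ * X]ger0_norm; last by lra.
  rewrite -normrM E normrN normrM; apply: ler_pM => //.
  by move: e1; rewrite !ler_norml => /andP[? ?]; apply/andP; split; lra.
have := normr_ge0 (t - u); nra.
Qed.

Let j1 : 'I_2 := lift ord0 ord0.

(* Small balls, translated in the direction of the centres of the circles. *)
Lemma exponents_circles_ge2 (alpha : R) (p q : \bar R) (C : R) :
  (1 <= p)%E -> (1 <= q)%E -> @spherical_estimate R 2 alpha p q C ->
  2 <= alpha <= 3 -> (4 - alpha) * fine p^-1 <= 1.
Proof.
move=> p1 q1 HC /andP[a1 a2].
pose beta := alpha - 2.
have b01 : 0 <= beta <= 1 by rewrite /beta; apply/andP; split; lra.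
have [b0 b1] := andP b01.
pose c := @c0 R 2.
have c_0 : 0 < c by exact: c0_gt0.
have c_1 : c <= 1 / (100 * 100) by exact: c0_le.
have c4 : 0 < c / 4 by rewrite divr_gt0.
have [k k0 kE] : exists2 k : R, 0 < k & k = 600 by exists 600; lra.
(* Twice the claim: averages of about [e^2], about [e^(-2 beta)] plates of area [e^4], and mass
   bounded below. *)
suff : (4 - 2 * beta) * fine p^-1 <= 2 + 0 * fine q^-1.
  by rewrite mul0r addr0 /beta; lra.
apply: (@test_exponents R _ _ _ _ _ (@avg_const R 2 * c)
  (c / 40 * (c / 4 * (c / 4))) ((2 * (k * c)) ^+ 2) `|C|).
- by rewrite mulr_gt0// avg_const_gt0.
- by rewrite !mulr_gt0// divr_gt0.
- exact: sqr_ge0.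
move=> e /andP[e0 e1].
have e01 : 0 < e <= 1 by rewrite e0.
have e2 : 0 < e ^+ 2 by rewrite exprn_gt0.
pose w := e ^+ 2.
have w0 : 0 < w by [].
have w1 : w <= 1 by rewrite expr_le1// ltW.
have w01 : 0 < w <= 1 by rewrite w0.
(* In the plane, the plate of index 1 has no direction along the cap. Taking [eta = e] makes the
   tolerance [delta / eta^2] the constant [c], which leaves room for the free radius. *)
pose delta := c * w.
have de0 : 0 < delta by rewrite mulr_gt0.
have de1 : delta <= c by rewrite ler_piMr// ltW.
have [N N1 N2] := progression_length w01 b0.
pose sg := c * w `^ beta.
pose g (b : 'rV[R]_2) := Num.sqrt ((3 / 2 + b ord0 j1) ^+ 2 - b ord0 ord0 ^+ 2) - 3 / 2.
(* Translations along axis [j1] change [focal], so [focal_graph_test] does not apply. The second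
   coordinate of the centre carries the progression and is the sheared one; the radius ranges over
   an interval of fixed length. *)
pose Phi (u : 'rV[R]_3) : 'rV[R]_2 * R :=
  (\row_i (if i == ord0 then tail u ord0 ord0 else u ord0 ord0 + g (tail u)),
   3 / 2 + tail u ord0 j1).
pose S := ord_cons (progression N sg (c * w / 4)) (fun _ : 'I_2 => interval_set 0 (c / 4)).
pose G := ord_cons (fun u : 'rV[R]_3 => g (tail u)) (fun (_ : 'I_2) _ => 0).
pose theta := ord_cons beta (fun _ : 'I_2 => 1).
pose B := ord_cons (10 * w `^ (1 - beta)) (fun _ : 'I_2 => 2 * (c / 4) `^ (1 - 1)).
pose L := ord_cons (c / 4 * w `^ (1 - beta)) (fun _ : 'I_2 => 2 * (c / 4)).
pose y0 (i : nat) : 'rV[R]_2 := on_second (i%:R * sg).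
have wb0 : 0 < w `^ (1 - beta) by exact: powR_gt0.
have mg : measurable_fun setT (fun u : 'rV[R]_3 => g (tail u)).
  apply: measurable_funB; last exact: measurable_cst.
  apply: (@measurableT_comp _ _ _ _ _ _ (@Num.sqrt R)).
    exact: continuous_measurable_fun (@sqrt_continuous R).
  have mc l : measurable_fun setT (fun u : 'rV[R]_3 => tail u ord0 l).
    exact: measurableT_comp (measurable_coord l) measurable_tail.
  apply: measurable_funB; apply: measurable_funX => //.
  by apply: measurable_funD => //; exact: measurable_cst.
have mPhi : measurable_fun setT Phi.
  have mt l : measurable_fun setT (fun u : 'rV[R]_3 => tail u ord0 l).
    exact: measurableT_comp (measurable_coord l) measurable_tail.
  apply: measurable_fun_pair; last by apply: measurable_funD => //; exact: measurable_cst.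
  apply: measurable_fun_rV; apply: ord2P; under eq_fun do rewrite mxE /=.
    exact: mt.
  by apply: measurable_funD => //; exact: measurable_coord.
have E1 : \prod_i (L i / B i) = c / 40 * (c / 4 * (c / 4)).
  rewrite big_ord_recl /L /B !ord_cons0.
  under eq_bigr do rewrite !ord_consS.
  rewrite !big_ord_recl big_ord0 subrr powRr0.
  by field; rewrite gt_eqF.
have E2 : plate_bound j1 delta e = (2 * (k * c)) ^+ 2 * e `^ 4.
  by rewrite /plate_bound -kE powR_mulrn ?(ltW e0)//= subnn /delta /w; ring.
have E3 : w `^ (- beta) * plate_bound j1 delta e =
    (2 * (k * c)) ^+ 2 * e `^ (4 - 2 * beta).
  rewrite E2 (powR_add 4 (- (2 * beta)) e0) -mulrN [e `^ (2 * _)]powRrM.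
  by rewrite [e `^ 2]powR_mulrn ?(ltW e0)// -/w; ring.
have boxP (u : 'rV[R]_3) : box S u -> exists2 i, (i < N)%N &
    [/\ `|u ord0 ord0 - i%:R * sg| <= delta / 4, `|tail u ord0 ord0| <= c / 4 &
        `|tail u ord0 j1| <= c / 4].
  move=> Su; have := Su ord0; rewrite /S ord_cons0 => -[i iN ui].
  exists i => //; split; first exact: ui.
    by have := Su (lift ord0 ord0); rewrite /S ord_consS /interval_set /= subr0 mxE.
  by have := Su (lift ord0 j1); rewrite /S ord_consS /interval_set /= subr0 mxE.
have key (u : 'rV[R]_3) (i : nat) : `|u ord0 ord0 - i%:R * sg| <= delta / 4 ->
    `|tail u ord0 ord0| <= c / 4 -> `|tail u ord0 j1| <= c / 4 ->
    let X := (u ord0 ord0 - i%:R * sg) + g (tail u) in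
    `|X| <= c /\ `|3 / 2 + tail u ord0 j1 -
       Num.sqrt ((3 / 2 + X) ^+ 2 + tail u ord0 ord0 ^+ 2)| <= delta.
  by move=> u1 u2 u3; exact: inverse_focal.
have := @spherical_estimate_pushforward R 2 3 alpha p q C theta B L S G Phi
  (plate_union N y0 j1 delta e) (@avg_const R 2 * c * w)
  (w `^ (- beta) * plate_bound j1 delta e) p1 q1 HC mPhi.
rewrite E1 E3 powRr0 mulr1 powR_mulrn ?(ltW e0)// -/w; apply.
- apply: (ord_cons_ind (P := fun _ => measurable)); first exact: measurable_progression.
  by move=> l; exact: measurable_interval_set.
- by apply: (ord_cons_ind (P := fun _ => measurable_fun setT)).
- apply: forall_ord_cons => [u v uv|l u v _]; last by rewrite /G !ord_consS.
  rewrite /G !ord_cons0; congr (g _); apply/rowP => l; rewrite !mxE.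
  exact: uv.
- apply: (ord_cons_ind (P := fun _ r => 0 < r)) => [|l]; first by rewrite mulr_gt0.
  by rewrite subrr powRr0 mulr1.
- apply: (ord_cons_ind (P := fun _ r => 0 < r)) => [|l]; first by rewrite mulr_gt0.
  by rewrite mulr_gt0.
- rewrite big_ord_recl /theta ord_cons0; under eq_bigr do rewrite ord_consS.
  by rewrite !big_ord_recl big_ord0 /beta; ring.
- apply: forall_ord_cons => [a r r0|l a r r0].
    rewrite /S /B /theta !ord_cons0.
    by apply: lebesgue_progression_cap => //; apply/andP; split=> //; lra.
  rewrite /S /B /theta !ord_consS; apply: lebesgue_interval_cap => //.
  by rewrite ler01 lexx.
- apply: forall_ord_cons => [|l]; first by rewrite /S /L !ord_cons0; exact: progression_lower.
  by rewrite /S /L !ord_consS; exact/lebesgue_measure_ball_ge/ltW.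
- move=> z r r0.
  exists (ord_cons (z.1 ord0 j1) (fun l : 'I_2 =>
    if l == ord0 then z.1 ord0 ord0 else z.2 - 3 / 2)) => u Su zu.
  have H l := le_trans (coord_le_enorm1 (Phi u - z) l) (ltW zu).
  have H2 := le_trans (snd_le_enorm1 (Phi u - z)) (ltW zu).
  apply: forall_ord_cons => [|].
    by rewrite /G !ord_cons0; have := H j1; rewrite !mxE.
  apply: ord2P; rewrite /G !ord_consS addr0 /=.
    by have := H ord0; rewrite !mxE.
  move: H2; rewrite /= mxE; congr (`|_| <= _); ring.
- exact: measurable_plate_union.
- by rewrite mulr_ge0 ?powR_ge0 ?sqr_ge0.
- apply: le_trans (lebesgue_plate_union_le _ _ _ (ltW de0) (ltW e0)) _.
  rewrite lee_fin -E3 ler_wpM2r// E2 mulr_ge0 ?powR_ge0 ?sqr_ge0//.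
- by rewrite !mulr_ge0 ?(ltW c_0) ?(ltW w0)// ltW// avg_const_gt0.
- move=> u /boxP[i iN [u1 u2 u3]].
  have [X1 _] := key u i u1 u2 u3.
  have := progression_index_le iN c_0 N1 w0; rewrite -/sg => /andP[i0 i1].
  split=> /=.
    rewrite /eball /= subr0; apply: (@enorm_le_small R 2 _ (2 * c)) => //.
      by rewrite mulr_ge0// ltW.
    apply: ord2P; rewrite mxE /=; first by apply: (le_trans u2); lra.
    move: X1; rewrite !ler_norml => /andP[? ?]; apply/andP; split; lra.
  by rewrite in_itv/=; move: u3; rewrite ler_norml => /andP[? ?]; apply/andP; split; lra.
- move=> u /boxP[i iN [u1 u2 u3]].
  have [X1 X2] := key u i u1 u2 u3.
  have dee : delta <= @c0 R 2 * e ^+ 2 by [].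
  have -> : @avg_const R 2 * c * w =
      @avg_const R 2 * (delta ^+ j1 * e ^+ (2.-1 - j1)).
    by rewrite /delta /= expr0 expr1; ring.
  apply: (sphere_measure_plate (y0 := y0 i) e01 de0 dee).
  - exact: measurable_plate_union.
  - by move=> y Py; exists i => //; exact: translated_plateP.
  have Xj : ((Phi u).1 - y0 i) ord0 j1 = (u ord0 ord0 - i%:R * sg) + g (tail u).
    by rewrite !mxE /=; ring.
  have X0 : ((Phi u).1 - y0 i) ord0 ord0 = tail u ord0 ord0.
    by rewrite !mxE /= subr0.
  split.
  + by apply: ord2P; rewrite ?ltnn// => _; rewrite X0 -/c; apply: (le_trans u2); lra.
  + by apply: ord2P.
  + by rewrite Xj mulfK ?gt_eqF.
  + rewrite /focal Xj big_mkcond !big_ord_recl big_ord0 /= X0 !addr0.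
    exact: X2.
Qed.

Lemma exponents_circles (alpha : R) (p q : \bar R) (C : R) :
  (1 <= p)%E -> (1 <= q)%E -> @spherical_estimate R 2 alpha p q C ->
  1 < alpha <= 3 -> (4 - alpha) * fine p^-1 <= 1.
Proof.
move=> p1 q1 HC /andP[a1 a3]; have [a2|a2] := leP alpha 2.
  by apply: (exponents_circles_le2 p1 q1 HC); rewrite a1.
by apply: (exponents_circles_ge2 p1 q1 HC); rewrite (ltW a2).
Qed.

End circles_wide.

(** * The necessary conditions *)

Lemma le_of_inverse (R : realType) (x : R) (p : \bar R) : (1 <= p)%E ->
  x * fine p^-1 <= 1 -> (x%:E <= p)%E.
Proof.
case: p => [r| |//]; last by move=> _ _; exact: leey.
rewrite !lee_fin fine_invr => r1.
by rewrite ler_pdivrMr ?mul1r// (lt_le_trans ltr01).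
Qed.

Theorem proposition4p1 (R : realType) (d : nat) (alpha : R) (p q : \bar R) :
  (2 <= d)%N -> 1 < alpha <= d.+1%:R -> (1 <= p)%E -> (1 <= q)%E ->
  (exists C : R, forall (f : 'rV[R]_d -> R)
      (nu : {measure set ('rV[R]_d * R) -> \bar R}),
    f \in Lfun (lebesgue_rV d) p -> frostman_class alpha nu ->
    ('N[nu]_q[spherical_average f \_ (eball 0%R 1%R `*` `]1%R, 2%R[)]
     <= C%:E * frostman_const alpha nu `^ fine q^-1
        * 'N[lebesgue_rV d]_p[EFin \o f])%E) ->
  let rp := fine (p^-1)%E in
  let rq := fine (q^-1)%E in
  [/\ (* (i) *)
      rp <= alpha * rq,
      (* (ii) *)
      (alpha <= d%:R -> d.+1%:R * rp <= d%:R - 1 + (alpha - 1) * rq) /\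
      (d%:R < alpha ->
        d.+1%:R * rp <= d%:R - 1 + (2 * alpha - d%:R - 1) * rq),
      (* (iii) *)
      (alpha <= d%:R -> d%:R * rp <= d%:R - 1) /\
      (d%:R < alpha -> d%:R * rp <= d%:R - 1 + (alpha - d%:R) * rq),
      (* (iv) and (v) *)
      (3 <= d)%N -> forall k : nat, (1 <= k <= d.-1)%N ->
        k%:R < alpha <= k.+1%:R ->
        ((d + k)%:R * rp <= (d + k)%:R - 2 + (alpha - k%:R) * rq /\
         rp <= ((d + k)%:R - 1) / (d + k + 1)%:R) /\
        (k.+1%:R * rp <= k%:R + (alpha - k%:R) * rq /\
         rp <= k.+1%:R / k.+2%:R)
    & (* (vi) *)
      d = 2%N -> ((4 - alpha)%:E <= p)%E].
Proof.
move=> d2 /andP[a1 ad] p1 q1 [C HC] rp rq.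
have {}HC : @spherical_estimate R d alpha p q C := HC.
have d0 : (0 < d)%N by exact: ltnW.
have D2 : 2 <= d%:R :> R by rewrite (ler_nat R 2).
have ad' : alpha <= d%:R + 1 by rewrite natr1.
have ratio (x y : R) : 0 <= x <= y -> 0 < y -> 0 <= x / y <= 1.
  move=> /andP[x0 xy] y0.
  by rewrite divr_ge0 ?(ltW y0)//= ler_pdivrMr// mul1r.
have r0 : 0 <= (0 : R) <= 1 by rewrite lexx ler01.
have r1 : 0 <= (1 : R) <= 1 by rewrite lexx ler01.
have wide (j : nat) (tw t : R) : (j < d)%N -> 0 <= tw <= 1 -> 0 <= t <= 1 ->
    j%:R * tw + (d%:R + 1 - j%:R) * t = alpha ->
    (j%:R + 1) * rp <= j%:R + (d%:R + 1 - j%:R) * t * rq.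
  move=> jd tw1 t1; have := exponents_wide (j := Ordinal jd) p1 q1 HC tw1 t1.
  by rewrite /= -[j.+1%:R]natr1 natrB 1?ltnW 1?ltnS 1?ltnW// -[d.+1%:R]natr1.
(* [tt] is the exponent of the radius, [tu] of the [j + 1] long sides, [tv] of the sides of length
   about [sqrt delta]. *)
have narrow (j : nat) (tt tu tv : R) : (j < d)%N ->
    0 <= tt <= 1 -> 0 <= tu <= 1 -> 0 <= tv <= 1 ->
    tt + (j%:R + 1) * tu + (d%:R - 1 - j%:R) * tv = alpha ->
    (d%:R + j%:R + 1) * rp <=
      d%:R + j%:R - 1 + (2 * tt + (d%:R - 1 - j%:R) * tv) * rq.
  move=> jd tt1 tu1 tv1.
  have := exponents_narrow (j := Ordinal jd) p1 q1 HC tt1 tu1 tv1.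
  have -> : (d.-1 - Ordinal jd)%:R = d%:R - 1 - j%:R :> R.
    rewrite natrB; last by rewrite -ltnS prednK.
    by rewrite -subn1 (natrB _ d0).
  by rewrite /= -natr1 addnS -natr1 natrD.
(* For [j = d - 1] all [d] centre coordinates are long and share [alpha] equally, so no [1/q]
   appears. *)
have H3 : alpha <= d%:R -> d%:R * rp <= d%:R - 1.
  move=> a_d.
  have jd : (d.-1 < d)%N by rewrite prednK.
  have dp : (d.-1)%:R = d%:R - 1 :> R by rewrite -subn1 natrB.
  have t01 : 0 <= alpha / d%:R <= 1 by apply: ratio; [apply/andP; split|]; lra.
  have := narrow _ _ _ _ jd r0 t01 r0; rewrite dp.
  have -> : 0 + (d%:R - 1 + 1) * (alpha / d%:R) + (d%:R - 1 - (d%:R - 1)) * 0 = alpha.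
    by field; lra.
  by move=> /(_ erefl); lra.
split.
(* Index 0 and [eta = 1]: E is a shell, every side shrinks, and [alpha] is spread evenly. *)
- have t01 : 0 <= alpha / (d%:R + 1) <= 1 by apply: ratio; [apply/andP; split|]; lra.
  have := wide _ _ _ d0 r0 t01.
  have E : (d%:R + 1 - 0) * (alpha / (d%:R + 1)) = alpha by field; lra.
  by rewrite E => H; have {H} := H _; lra.
- split=> a_d.
    (* The single long side is saturated; the rest of [alpha] goes to the sides of length about
       [sqrt delta]. *)
    have t01 : 0 <= (alpha - 1) / (d%:R - 1) <= 1 by apply: ratio; [apply/andP; split|]; lra.
    have := narrow _ _ _ _ d0 r0 r1 t01.
    have E : (d%:R - 1 - 0) * ((alpha - 1) / (d%:R - 1)) = alpha - 1 by field; lra.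
    by rewrite E -natr1 => H; have {H} := H _; lra.
  (* All centre coordinates are saturated, and the excess falls on the radius. *)
  have t01 : 0 <= alpha - d%:R <= 1 by apply/andP; split; lra.
  have := narrow _ _ _ _ d0 t01 r1 r1.
  by rewrite -natr1 => H; have {H} := H _; lra.
- split=> // a_d.
  have t01 : 0 <= alpha - d%:R <= 1 by apply/andP; split; lra.
  have jd : (d.-1 < d)%N by rewrite prednK.
  have dp : (d.-1)%:R = d%:R - 1 :> R by rewrite -subn1 natrB.
  have := narrow _ _ _ _ jd t01 r1 r0.
  by rewrite dp => H; have {H} := H _; lra.
- move=> d3 k /andP[k1 kd] /andP[ka ak].
  have {}kd : (k < d)%N by rewrite -(prednK d0) ltnS.
  have K1 : 1 <= k%:R :> R by rewrite (ler_nat R 1).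
  have KD : k%:R + 1 <= d%:R :> R by rewrite natr1 ler_nat.
  rewrite -natr1 in ak.
  have t01 : 0 <= alpha / (k%:R + 1) <= 1 by apply: ratio; [apply/andP; split|]; lra.
  have tE : (k%:R + 1) * (alpha / (k%:R + 1)) = alpha by field; lra.
  rewrite !natrD -natr1 -[k.+2%:R]natr1 -natr1.
  split; split.
  (* Index [k - 1] has exactly [k] long sides, which are saturated. *)
  + have jd : (k.-1 < d)%N by exact: leq_ltn_trans (leq_pred k) kd.
    have kp : (k.-1)%:R = k%:R - 1 :> R by rewrite -subn1 natrB.
    have s01 : 0 <= (alpha - k%:R) / (d%:R - k%:R) <= 1.
      by apply: ratio; [apply/andP; split|]; lra.
    have E : (d%:R - k%:R) * ((alpha - k%:R) / (d%:R - k%:R)) = alpha - k%:R.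
      by field; lra.
    have := narrow _ _ _ _ jd r0 r1 s01; rewrite kp.
    have -> : d%:R - 1 - (k%:R - 1) = d%:R - k%:R :> R by ring.
    by rewrite E => H; have {H} := H _; lra.
  (* Index [k] has [k + 1] long sides, enough to carry all of [alpha]. *)
  + have := narrow _ _ _ _ kd r0 t01 r0; rewrite tE => H.
    by rewrite ler_pdivlMr; have {H} := H _; lra.
  + have s01 : 0 <= (alpha - k%:R) / (d%:R + 1 - k%:R) <= 1.
      by apply: ratio; [apply/andP; split|]; lra.
    have E : (d%:R + 1 - k%:R) * ((alpha - k%:R) / (d%:R + 1 - k%:R)) = alpha - k%:R.
      by field; lra.
    have := wide _ _ _ kd r1 s01.
    by rewrite E => H; have {H} := H _; lra.
  + rewrite ler_pdivlMr; last by lra.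
    (* Index [k + 1] has [k + 1] long sides when [eta = 1]. It exists only if [k + 1 < d]; for
       [k + 1 = d] condition (iii) is stronger, as [(d - 1) / d <= d / (d + 1)]. *)
    have [kd'|dk] := ltnP k.+1 d.
      have := wide _ _ _ kd' t01 r0; rewrite -natr1 tE => H.
      by have {H} := H _; lra.
    have dE : d%:R = k%:R + 1 :> R.
      by rewrite natr1; congr (_%:R); apply/eqP; rewrite eqn_leq dk kd.
    rewrite dE in H3; have := H3 ak; nra.
- move=> dE; subst d; apply: le_of_inverse => //.
  by apply: (exponents_circles p1 q1 HC); rewrite a1 ad.
Qed.
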